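(* Let $\Omega\subseteq\mathbb C^m$ be a bounded domain and let $K:\Omega\times\Omega\to\mathbb C$ be a positive definite kernel, holomorphic in the first variable and anti-holomorphic in the second, such that for every $w\in\Omega$ the $m+1$ vectors $K(\cdot,w),(\bar\partial_1K)(\cdot,w),\ldots,(\bar\partial_mK)(\cdot,w)$ are linearly independent. Then for every fixed $w\in\Omega$ and every $\lambda>0$, the $(m+1)\times(m+1)$ matrix $$\big(\,(\partial_j\bar\partial_iK^\lambda)(w,w)\,\big)_{i,j=0}^m$$ is positive definite.
   Context: A positive definite kernel is the reproducing kernel of a Hilbert space of functions on $\Omega$: all matrices $(K(z_i,z_j))_{i,j}$, $z_1,\dots,z_n\in\Omega$, are nonnegative definite. For $\lambda>0$, $K^\lambda(z,w)$ denotes the function (defined near the diagonal, holomorphic in $z$, anti-holomorphic in $w$) obtained by polarizing the real analytic function $w\mapsto K(w,w)^\lambda$. For $1\le i\le m$, $\partial_i$ denotes the derivative with respect to the $i$-th coordinate of the first variable, $\bar\partial_i$ denotes the derivative with respect to the conjugate of the $i$-th coordinate of the second variable, and $\partial_0=\bar\partial_0$ is the identity. Thus $(\partial_j\bar\partial_iK^\lambda)(w,w)=\frac{\partial^2}{\partial w_j\partial\bar w_i}\big(K(w,w)^\lambda\big)$ for $i,j\ge1$, with the obvious interpretation if $i$ or $j$ is $0$. *)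

(* Defs.v *)
From HB Require Import structures.
From mathcomp Require Import all_boot all_order all_algebra.
From mathcomp Require Import complex.
From mathcomp Require Import all_classical all_reals all_analysis.

Set Implicit Arguments.
Unset Strict Implicit.
Unset Printing Implicit Defensive.

Import Order.TTheory GRing.Theory Num.Theory numFieldNormedType.Exports.

Local Open Scope classical_set_scope.
Local Open Scope complex_scope.
Local Open Scope sesquilinear_scope.
Local Open Scope ring_scope.

(* [R[i]] seen through [numClosedFieldType], which is what gives it the norm
   and the topology of a [normedModType] over itself; all derivatives below are
   therefore complex derivatives. *)
Definition CC (R : realType) : numClosedFieldType := R[i].

(* In the order of [numClosedFieldType], [0 <= x] and [0 < x] include that [x]
   is real; hence such matrices are automatically Hermitian. *)
Definition nonneg_definite (C : numClosedFieldType) (n : nat) (A : 'M[C]_n) :=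
  forall v : 'rV[C]_n, 0 <= (v *m A *m v ^t*) 0 0.

Definition pos_definite (C : numClosedFieldType) (n : nat) (A : 'M[C]_n) :=
  forall v : 'rV[C]_n, v != 0 -> 0 < (v *m A *m v ^t*) 0 0.

Section Kernels.
Variables (R : realType) (m : nat).
Local Notation C := (CC R).
Local Notation V := 'rV[C]_m.

Definition conj_vec (w : V) : V := map_mx Num.conj w.

Definition bounded_domain (Omega : set V) :=
  [/\ open Omega, connected Omega, Omega !=set0 & bounded_set Omega].

(* Kernels are total functions of which only the values on the relevant open
   set matter; there, [F] is holomorphic in its first variable and
   anti-holomorphic in its second one when [(z, u) |-> F z (conj u)] is a
   holomorphic function of the [2m] variables [(z, u)]. *)
Definition sesquiholomorphic (W : set (V * V)) (F : V -> V -> C) :=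
  forall p, W p ->
    differentiable (fun q : V * V => F q.1 (conj_vec q.2)) (p.1, conj_vec p.2).

Definition positive_definite_kernel (Omega : set V) (K : V -> V -> C) :=
  forall (n : nat) (z : 'I_n -> V), (forall i, Omega (z i)) ->
    nonneg_definite (\matrix_(i, j) K (z i) (z j)).

(* Index [ord0] stands for the identity, index [lift ord0 k] for the
   derivative with respect to the [k]-th coordinate. *)
Definition partial (i : 'I_m.+1) (F : V -> V -> C) : V -> V -> C :=
  fun z w => if unlift ord0 i is Some k
             then 'D_(delta_mx 0 k) (fun u : V => F u w) z
             else F z w.

(* The conjugate coordinates of the second variable are the coordinates of
   [u = conj_vec w]. *)
Definition partial_bar (i : 'I_m.+1) (F : V -> V -> C) : V -> V -> C :=
  fun z w => if unlift ord0 i is Some k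
             then 'D_(delta_mx 0 k) (fun u : V => F z (conj_vec u)) (conj_vec w)
             else F z w.

Definition independent_at (Omega : set V) (K : V -> V -> C) (w : V) :=
  forall c : 'rV[C]_m.+1,
    (forall z, Omega z -> \sum_i c 0 i * partial_bar i K z w = 0) -> c = 0.

(* [F] polarizes [w |-> K(w, w) ^ lambda] near the diagonal of [Omega]. *)
Definition is_kernel_power (Omega : set V) (K : V -> V -> C) (lambda : R)
    (F : V -> V -> C) :=
  exists W : set (V * V),
    [/\ open W,
        W `<=` Omega `*` Omega,
        forall w, Omega w -> W (w, w),
        sesquiholomorphic W F &
        forall w, Omega w -> F w w = (complex.Re (K w w) `^ lambda)%:C].

(* A polarization is determined near the diagonal, so that the derivatives of
   [kernel_power] on the diagonal do not depend on the choice made by [xget]. *)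
Definition kernel_power (Omega : set V) (K : V -> V -> C) (lambda : R) :
    V -> V -> C :=
  xget (fun _ _ => 0) [set F | is_kernel_power Omega K lambda F].

End Kernels.

(* Main.v *)
(* Let k = K(w,w) > 0, and let Q(x, v) = |x|^2 k + x a + conj(x) b + g be the
   quadratic form of the matrix for lambda = 1; it is the squared norm of a
   combination of K(.,w) and its derivatives, hence positive by independence.
   For general lambda the chain rule turns the form into
     k^(lambda-2) |k x + lambda b|^2 + lambda k^(lambda-1) (g - a b / k),
   where g - a b / k = Q(- b / k, v) > 0 unless v = 0.
   The power K^lambda exists near the diagonal as exp (lambda log K), with the
   principal logarithm where Re K > 0. Two polarizations have the same first and
   mixed second derivatives on the diagonal, because the diagonal is totally
   real: a holomorphic function vanishing there has zero differential there, and
   the same applies to its partial derivatives.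
   Holomorphic functions are only assumed to be complex differentiable at every
   point, so that the existence of second derivatives rests on the argument of
   Goursat. It is carried out with Riemann sums: the averages of f over 2^n-th
   roots of unity give |f 0| <= max |f| on circles, Cauchy estimates follow, and
   these control difference quotients. *)

Require Import Defs.
From HB Require Import structures.
From mathcomp Require Import all_boot all_order all_algebra.
From mathcomp Require Import complex.
From mathcomp Require Import all_classical all_reals all_analysis.
From mathcomp Require Import ring lra.
Import Order.TTheory GRing.Theory Num.Theory numFieldNormedType.Exports.
Local Open Scope classical_set_scope.
Local Open Scope ring_scope.

Set Implicit Arguments.
Unset Strict Implicit.

(** * Discrete contour sums *)

(** No Hilbert space is constructed: its role is played by one extra point. Positivity of the kernel
    on [z], [w] and a point near [w] gives a quadratic form in an additional weight [y] at [z]. If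
    the jet at [w] had norm zero, the part linear in [y] would vanish for every [z]; this is
    orthogonality to all [K(., z)], which independence excludes. The averages over roots of unity
    need only continuity at the centre of the circle. Hence they apply to a difference quotient
    completed by the derivative, and the Cauchy estimate comes without an integral formula or a
    removable singularity theorem. Its constants are not optimal, but only their finiteness matters.
    Every [lambda > 0] is admissible because the product [a b] enters with factor
    [lambda (lambda - 1)] from the chain rule and with [- lambda ^ 2] from completing the square:
    [- lambda a b] remains, as in the case [lambda = 1] up to the factor [lambda]. *)

Lemma differentiable_remainder (K : numFieldType) (V W : normedModType K)
    (f : V -> W) (a : V) (e : K) : differentiable f a -> 0 < e ->
  \forall x \near a, `|f x - f a - 'd f a (x - a)| <= e * `|x - a|.
Proof.
move=> /diff_locally /eqaddoP df e0.
have := df _ e0; rewrite -nbhs_nearE => H.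
apply/nbhs0P; move: H; apply: filterS => h /=.
by rewrite opprD -![(_ + _ : _ -> _) _]/(_ + _) -![(- _ : _ -> _) _]/(- _) /=
  /shift /cst addrA [a + h]addrC addrK.
Qed.

(** Nested dyadic intervals: the bit [d] selects a half of the current one, and the supremum of the
    left end points lies in all of them. Both subdivision arguments below find their limit point
    this way. *)
Lemma dyadic_limit (R : realType) (a : nat -> nat) :
    (forall k, exists d : bool, a k.+1 = ((a k).*2 + d)%N) ->
  exists x : R, forall k,
    (a k)%:R / 2 ^+ k <= x <= (a k).+1%:R / 2 ^+ k.
Proof.
move=> ad.
pose u k : R := (a k)%:R / 2 ^+ k; pose v k : R := (a k).+1%:R / 2 ^+ k.
have p2 k : (0 : R) < 2 ^+ k by rewrite exprn_gt0.
have uS k : u k <= u k.+1.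
  rewrite /u; have [d ->] := ad k.
  by rewrite exprS invfM mulrA ler_wpM2r ?invr_ge0 ?(ltW (p2 k))//
    ler_pdivlMr// -natrM ler_nat muln2 leq_addr.
have vS k : v k.+1 <= v k.
  rewrite /v; have [d ->] := ad k.
  rewrite exprS invfM mulrA ler_wpM2r ?invr_ge0 ?(ltW (p2 k))//.
  rewrite ler_pdivrMr// -natrM ler_nat -muln2.
  by case: d; rewrite ?addn1 ?addn0 mulSn addnC addn2// ltnW.
have um : {homo u : n m / (n <= m)%N >-> n <= m}.
  by apply: homo_leq => // y x z; apply: le_trans.
have vm : {homo v : n m / (n <= m)%N >-> n >= m}.
  by apply: homo_leq => // y x z /[swap]; apply: le_trans.
have uv k : u k <= v k.
  by rewrite /u /v ler_wpM2r ?invr_ge0 ?(ltW (p2 k))// ler_nat.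
have uvn n k : u n <= v k.
  apply: (le_trans (um _ _ (leq_maxl n k))).
  exact: (le_trans (uv _) (vm _ _ (leq_maxr n k))).
exists (sup (range u)) => k; apply/andP; split.
  apply: ub_le_sup; last by exists k.
  by exists (v 0%N) => _ [n _ <-].
apply: ge_sup; first by exists (u 0%N); exists 0%N.
by move=> _ [n _ <-]; exact: uvn.
Qed.

Section Loop.
Variables (A : ringType) (h : A -> A) (pt : nat -> nat -> A).

(* Twice the trapezoid rule on the edge from [p] to [q]: it is exact on affine
   functions, so that loops see only the second-order part of [h]. *)
Definition edge (p q : A) := (h p + h q) * (q - p).

Definition hsum i j l := \sum_(k < l) edge (pt (i + k) j) (pt (i + k).+1 j).
Definition vsum i j l := \sum_(k < l) edge (pt i (j + k)) (pt i (j + k).+1).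
(** Contour sum around the square of side [l] with lower left corner [(i, j)]. Reversing an edge
    changes the sign of [edge], hence the two subtracted sides. *)
Definition loop i j l :=
  hsum i j l + vsum (i + l) j l - hsum i (j + l) l - vsum i j l.

Lemma hsumD i j l l' : hsum i j (l + l') = hsum i j l + hsum (i + l) j l'.
Proof.
rewrite /hsum big_split_ord /=; congr (_ + _).
by apply: eq_bigr => k _; rewrite addnA.
Qed.

Lemma vsumD i j l l' : vsum i j (l + l') = vsum i j l + vsum i (j + l) l'.
Proof.
rewrite /vsum big_split_ord /=; congr (_ + _).
by apply: eq_bigr => k _; rewrite addnA.
Qed.

End Loop.

(** Sides shared by two of the four subsquares are traversed in opposite directions and cancel. *)
Lemma loop_quadrisect (A : comRingType) (h : A -> A) pt i j l :
  loop h pt i j l.*2 = loop h pt i j l + loop h pt (i + l) j l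
    + loop h pt i (j + l) l + loop h pt (i + l) (j + l) l.
Proof.
by rewrite /loop -addnn !hsumD !vsumD !addnA; ring.
Qed.

Lemma loopB (A : comRingType) (h g : A -> A) pt i j l :
  loop (fun z => h z - g z) pt i j l = loop h pt i j l - loop g pt i j l.
Proof.
have eB p q : edge (fun z => h z - g z) p q = edge h p q - edge g p q.
  by rewrite /edge; ring.
have hB i' j' : hsum (fun z => h z - g z) pt i' j' l
    = hsum h pt i' j' l - hsum g pt i' j' l.
  by rewrite -sumrB; apply: eq_bigr.
have vB i' j' : vsum (fun z => h z - g z) pt i' j' l
    = vsum h pt i' j' l - vsum g pt i' j' l.
  by rewrite -sumrB; apply: eq_bigr.
by rewrite /loop !hB !vB; ring.
Qed.

(** [psi] is a primitive of twice the affine function. The trapezoid rule reproduces its increments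
    exactly, so each side telescopes and the closed contour gives zero. *)
Lemma loop_affine (A : comRingType) (a b c : A) pt i j l :
  loop (fun z => a + b * (z - c)) pt i j l = 0.
Proof.
pose psi z := a *+ 2 * z + b * (z - c) ^+ 2.
have e p q : edge (fun z => a + b * (z - c)) p q = psi q - psi p.
  by rewrite /edge /psi; ring.
have H i' j' : hsum (fun z => a + b * (z - c)) pt i' j' l
    = psi (pt (i' + l)%N j') - psi (pt i' j').
  rewrite /hsum; under eq_bigr do rewrite e.
  rewrite -(big_mkord xpredT (fun k => psi (pt (i' + k).+1 j') - psi (pt (i' + k)%N j'))).
  under eq_bigr do rewrite -addnS.
  by rewrite (telescope_sumr (fun k => psi (pt (i' + k)%N j')))// addn0.
have V i' j' : vsum (fun z => a + b * (z - c)) pt i' j' l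
    = psi (pt i' (j' + l)%N) - psi (pt i' j').
  rewrite /vsum; under eq_bigr do rewrite e.
  rewrite -(big_mkord xpredT (fun k => psi (pt i' (j' + k).+1) - psi (pt i' (j' + k)%N))).
  under eq_bigr do rewrite -addnS.
  by rewrite (telescope_sumr (fun k => psi (pt i' (j' + k)%N)))// addn0.
by rewrite /loop !H !V; ring.
Qed.

(** The constant [8] counts four sides and the two end point values of [h] on each edge. *)
Lemma loop_le (A : numDomainType) (h : A -> A) pt i j l (e d : A) :
    (forall k k', (k <= l)%N -> (k' <= l)%N ->
       `|h (pt (i + k)%N (j + k')%N)| <= e) ->
    (forall k k', `|pt k.+1 k' - pt k k'| <= d) ->
    (forall k k', `|pt k k'.+1 - pt k k'| <= d) ->
  `|loop h pt i j l| <= l%:R * (8 * (e * d)).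
Proof.
move=> he hd vd.
have edge_le p q : `|h p| <= e -> `|h q| <= e -> `|q - p| <= d ->
    `|edge h p q| <= 2 * (e * d).
  move=> hp hq pq; rewrite /edge normrM mulrA ler_pM// mulr_natl mulr2n.
  by rewrite (le_trans (ler_normD _ _))// lerD.
have sum_le (F : 'I_l -> A) :
    (forall k, `|F k| <= 2 * (e * d)) -> `|\sum_k F k| <= l%:R * (2 * (e * d)).
  move=> hF; rewrite (le_trans (ler_norm_sum _ _ _))//.
  rewrite (le_trans (ler_sum _ (fun k _ => hF k)))//.
  by rewrite sumr_const card_ord [leRHS]mulr_natl.
have H k' : (k' <= l)%N -> `|hsum h pt i (j + k') l| <= l%:R * (2 * (e * d)).
  move=> lk; apply: sum_le => k; apply: edge_le => //.
    by apply: he => //; apply: ltnW.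
  by rewrite -addnS; apply: he.
have V k' : (k' <= l)%N -> `|vsum h pt (i + k') j l| <= l%:R * (2 * (e * d)).
  move=> lk; apply: sum_le => k; apply: edge_le => //.
    by apply: he => //; apply: ltnW.
  by rewrite -addnS; apply: he.
have := H 0%N (leq0n _); have := V 0%N (leq0n _).
have := H l (leqnn _); have := V l (leqnn _); rewrite !addn0 /loop.
set x := vsum _ _ _ _ _; set y := hsum _ _ _ _ _; set z := vsum _ _ _ _ _.
set t := hsum _ _ _ _ _ => hx hy hz ht.
have -> : l%:R * (8 * (e * d)) = l%:R * (2 * (e * d)) + l%:R * (2 * (e * d))
   + l%:R * (2 * (e * d)) + l%:R * (2 * (e * d)) by ring.
do 3 ![apply: (le_trans (ler_normD _ _)); rewrite lerD ?normrN//].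
Qed.

(** * Goursat's argument on Lipschitz images of a square *)

Definition toC (R : realType) : {rmorphism R -> CC R} := real_complex R.
Arguments toC R : simpl never.

Lemma toC_norm (R : realType) (x : R) : `|toC R x| = toC R `|x|.
Proof. by rewrite [LHS]normc_def /= expr0n /= addr0 sqrtr_sqr. Qed.

Lemma toC_le (R : realType) (x y : R) : (toC R x <= toC R y) = (x <= y).
Proof. exact: lecR. Qed.

Lemma toC_lt (R : realType) (x y : R) : (toC R x < toC R y) = (x < y).
Proof. exact: ltcR. Qed.

Lemma Re_le (R : realType) (z : CC R) : toC R `|complex.Re z| <= `|z|.
Proof. exact: normc_ge_Re. Qed.

Lemma Im_le (R : realType) (z : CC R) : toC R `|complex.Im z| <= `|z|.
Proof. by rewrite [leRHS]normc_def toC_le -sqrtr_sqr ler_wsqrtr// lerDr sqr_ge0. Qed.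

(** Nonnegative elements of the complex order are real, so radii and tolerances in [CC R] can be
    replaced by real numbers, for which the order is total. *)
Lemma ge0_toC (R : realType) (e : CC R) : 0 <= e -> exists2 r : R, 0 <= r & e = toC R r.
Proof.
case: e => a b; rewrite lecE /= => /andP[/eqP -> a0]; by exists a.
Qed.

Lemma gt0_toC (R : realType) (e : CC R) : 0 < e -> exists2 r : R, 0 < r & e = toC R r.
Proof.
move=> e0; have [r _ er] := ge0_toC (ltW e0); exists r => //.
by rewrite -toC_lt -er rmorph0.
Qed.

Section Goursat.
Variables (R : realType) (phi : R -> R -> CC R) (h : CC R -> CC R) (L : CC R).
Hypothesis L_gt0 : 0 < L.
Hypothesis phi_lip : forall s t s' t',
  `|phi s t - phi s' t'| <= L * toC R (`|s - s'| + `|t - t'|).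
Hypothesis dh : forall s t, 0 <= s <= 1 -> 0 <= t <= 1 ->
  differentiable h (phi s t).

(** The map [phi] is merely Lipschitz, so that a square may be wrapped around an annulus; only the
    mesh of the image grid enters the estimates. *)
Definition grid (n i j : nat) : CC R := phi (i%:R / 2 ^+ n) (j%:R / 2 ^+ n).

Lemma grid_step n i j :
  (`|grid n i.+1 j - grid n i j| <= L / 2 ^+ n) *
  (`|grid n i j.+1 - grid n i j| <= L / 2 ^+ n).
Proof.
have p2 : (0 : R) < 2 ^+ n by rewrite exprn_gt0.
have E (k : nat) : `|k.+1%:R / 2 ^+ n - k%:R / 2 ^+ n| = (2 ^+ n)^-1 :> R.
  rewrite -mulrBl -natr1 addrAC subrr add0r mul1r ger0_norm// invr_ge0 ltW//.
have E2 : toC R (2 ^+ n)^-1 = (2 ^+ n)^-1 by rewrite fmorphV rmorphXn /= rmorph_nat.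
split; rewrite /grid (le_trans (phi_lip _ _ _ _))// ler_wpM2l ?(ltW L_gt0)//.
  by rewrite E subrr normr0 addr0 E2.
by rewrite E subrr normr0 add0r E2.
Qed.

(* Quadrisection as in Goursat's proof, with trapezoid sums instead of contour
   integrals: a loop that stays large at infinitely many levels [n] has a
   quarter with the same property, and nested bad squares shrink to a point
   where [h] is differentiable. *)
Theorem goursat (e : CC R) : 0 < e ->
  exists n0, forall n, (n0 <= n)%N -> `|loop h (grid n) 0 0 (2 ^ n)| <= e.
Proof.
move=> e0; apply: contrapT => nH.
(* [B N k i j] belongs to the square [(i, j)] of level [k], sampled [N] levels finer. A sampled sum,
   unlike an integral, changes under refinement; therefore [bad] asks for large sums at arbitrarily
   fine sampling. *)
pose B N k i j := loop h (grid (k + N)) (i * 2 ^ N) (j * 2 ^ N) (2 ^ N).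
pose bad (x : nat * nat * nat) := let: (k, i, j) := x in
  forall N0, exists2 N, (N0 <= N)%N & ~ (`|B N k i j| <= e / 4 ^+ k).
have bad0 : bad (0, 0, 0)%N.
  move=> N0; apply: contrapT => H; apply: nH; exists N0 => n nN.
  apply: contrapT => H'; apply: H; exists n => //.
  by rewrite /B !mul0n add0n expr0 divr1.
have step x : exists d : bool * bool, bad x ->
    bad (x.1.1.+1, x.1.2.*2 + d.1, x.2.*2 + d.2)%N.
  case: x => -[k i] j /=; apply: contrapT => H.
  have good (d d' : bool) : bad (k, i, j) /\ exists N0, forall N, (N0 <= N)%N ->
      `|B N k.+1 (i.*2 + d)%N (j.*2 + d')%N| <= e / 4 ^+ k.+1.
    split.
      by apply: contrapT => nb; apply: H; exists (d, d') => /nb.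
    apply: contrapT => nb; apply: H; exists (d, d') => _ N0.
    apply: contrapT => nb'; apply: nb; exists N0 => N NN.
    by apply: contrapT => nb''; apply: nb'; exists N.
  have [bk [N1 H1]] := good false false; have [_ [N2 H2]] := good true false.
  have [_ [N3 H3]] := good false true; have [_ [N4 H4]] := good true true.
  (* Sampling a square [N.+1] levels finer samples its quarters [N] levels finer; hence the
     successor beyond the four thresholds. *)
  have [[|N] NN] := bk (maxn (maxn N1 N2) (maxn N3 N4)).+1; first by [].
  move: NN; rewrite ltnS !geq_max => /andP[/andP[/H1 b1 /H2 b2] /andP[/H3 b3 /H4 b4]].
  apply; rewrite /B expnS mul2n loop_quadrisect -addnn.
  have -> : e / 4 ^+ k = e / 4 ^+ k.+1 + e / 4 ^+ k.+1 + e / 4 ^+ k.+1 + e / 4 ^+ k.+1.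
    by rewrite exprS; field; rewrite expf_neq0 // pnatr_eq0.
  move: b1 b2 b3 b4; rewrite /B addnS addSn !addn0 !addn1 !mulSn -!muln2.
  have E2 l : (l * (2 ^ N + 2 ^ N) = l * 2 * 2 ^ N)%N by rewrite addnn -muln2 mulnAC mulnA.
  rewrite !E2 ![(2 ^ N + _)%N]addnC => b1 b2 b3 b4.
  by do 3 ![apply: (le_trans (ler_normD _ _)); rewrite lerD//].
have [f fP] := choice step.
pose st := fix st k : nat * nat * nat := if k is k'.+1 then
  let x := st k' in (x.1.1.+1, x.1.2.*2 + (f x).1, x.2.*2 + (f x).2)%N
  else (0, 0, 0)%N.
have stb k : bad (st k) by elim: k => //= k /fP.
have stk k : (st k).1.1 = k by elim: k => //= k ->.
have [x xP] : exists x : R, forall k,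
    ((st k).1.2)%:R / 2 ^+ k <= x <= ((st k).1.2).+1%:R / 2 ^+ k.
  by apply: dyadic_limit => k; exists (f (st k)).1.
have [y yP] : exists x : R, forall k,
    ((st k).2)%:R / 2 ^+ k <= x <= ((st k).2).+1%:R / 2 ^+ k.
  by apply: dyadic_limit => k; exists (f (st k)).2.
have x01 : 0 <= x <= 1 by have := xP 0%N; rewrite /= !divr1.
have y01 : 0 <= y <= 1 by have := yP 0%N; rewrite /= !divr1.
pose p := phi x y.
(* The final bound is [2 ^ N] times [8 * e1 * (2 L / 2 ^ k) * (L / 2 ^ (k + N))], that is,
   [16 L ^ 2 e1 / 4 ^ k]. *)
pose e1 := e / (16 * L ^+ 2).
have e10 : 0 < e1 by rewrite divr_gt0// mulr_gt0// exprn_gt0.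
have /nbhs_normP[d /= d0 hd] := differentiable_remainder (dh x01 y01) e10.
(* Both parameters of a sample point of the square differ from [(x, y)] by at most [1 / 2 ^ k], so
   its distance to [p] is at most [2 L / 2 ^ k]. *)
have [k kd] : exists k, L * 2 / 2 ^+ k < d.
  have [r r0 dr] := gt0_toC d0; have [l l0 Ll] := gt0_toC L_gt0.
  have [k kP] : exists k : nat, l * 2 / r < k%:R.
    exists (Num.trunc (l * 2 / r)).+1; exact: truncnS_gt.
  exists k; rewrite dr Ll.
  have -> : toC R l * 2 / 2 ^+ k = toC R (l * 2 / 2 ^+ k).
    by rewrite fmorph_div rmorphM rmorphXn /= !rmorph_nat.
  rewrite toC_lt ltr_pdivrMr ?exprn_gt0// [ltRHS]mulrC -ltr_pdivrMr//.
  apply: (lt_trans kP); rewrite -natrX ltr_nat; exact: ltn_expl.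
have := stb k; move: (xP k) (yP k) (stk k).
case: (st k) => -[k' i] j /= {}xP {}yP -> /(_ 0%N)[N _]; apply.
(* The affine part of [h] at [p] has loop sum zero; only the remainder has to be estimated. *)
pose q z := h p + 'd h p 1 * (z - p).
have dq z : 'd h p (z - p) = 'd h p 1 * (z - p).
  by rewrite -{1}[z - p]mulr1 -[(z - p) * 1]/((z - p) *: (1 : CC R)) linearZ /= mulrC.
have near_le c c' : (c <= 2 ^ N)%N -> (c' <= 2 ^ N)%N ->
   `|grid (k + N) (i * 2 ^ N + c) (j * 2 ^ N + c') - p| <= L * 2 / 2 ^+ k.
  have p2 m : (0 : R) < 2 ^+ m by rewrite exprn_gt0.
  have E u a b : (b <= 2 ^ N)%N -> a%:R / 2 ^+ k <= u <= a.+1%:R / 2 ^+ k ->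
      `|(a * 2 ^ N + b)%:R / 2 ^+ (k + N) - u| <= (2 ^+ k)^-1 :> R.
    move=> bN /andP[u1 u2].
    have e3 : (a * 2 ^ N + b)%:R / 2 ^+ (k + N) =
       a%:R / 2 ^+ k + (b%:R / 2 ^+ N) / 2 ^+ k :> R.
      rewrite natrD natrM natrX exprD; field.
      by rewrite !expf_neq0// pnatr_eq0.
    have b1 : b%:R / 2 ^+ N <= 1 :> R by rewrite ler_pdivrMr// mul1r -natrX ler_nat.
    have b0 : 0 <= b%:R / 2 ^+ N :> R by rewrite divr_ge0// ltW.
    have b1' : b%:R / 2 ^+ N / 2 ^+ k <= (2 ^+ k)^-1 :> R.
      by rewrite ler_piMl// invr_ge0 ltW.
    have b0' : 0 <= b%:R / 2 ^+ N / 2 ^+ k :> R by rewrite divr_ge0// ltW.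
    move: u2; rewrite -natr1 mulrDl mul1r => u2.
    by rewrite e3 ler_norml; apply/andP; split; lra.
  move=> cN c'N; rewrite /grid /p (le_trans (phi_lip _ _ _ _))// -mulrA.
  rewrite ler_wpM2l ?(ltW L_gt0)//.
  have -> : 2 / 2 ^+ k = toC R ((2 ^+ k)^-1 + (2 ^+ k)^-1).
    rewrite rmorphD fmorphV rmorphXn /= !rmorph_nat.
    by rewrite -[X in X / _ = _]/(1 + 1) mulrDl mul1r.
  by rewrite toC_le lerD// E.
have -> : B N k i j = loop (fun z => h z - q z) (grid (k + N)) (i * 2 ^ N) (j * 2 ^ N) (2 ^ N).
  by rewrite loopB loop_affine subr0.
rewrite (le_trans (loop_le (e := e1 * (L * 2 / 2 ^+ k)) (d := L / 2 ^+ (k + N)) _ _ _))//.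
- move=> c c' cN c'N; have nle := near_le _ _ cN c'N.
  set z := grid _ _ _ in nle *.
  rewrite /q opprD addrA -dq (le_trans (hd _ _))//=.
    by rewrite distrC (le_lt_trans nle).
  by rewrite ler_wpM2l// ltW.
- by move=> c c'; apply: (grid_step _ _ _).1.
- by move=> c c'; apply: (grid_step _ _ _).2.
rewrite le_eqVlt; apply/orP; left; apply/eqP.
have -> : (4 : CC R) ^+ k = 2 ^+ k * 2 ^+ k by rewrite -exprMn -natrM.
rewrite /e1 natrX exprD; field.
by rewrite !expf_neq0 ?gt_eqF.
Qed.

End Goursat.

(** * Mean values on circles *)

Lemma bounded_derivative_lipschitz (R : realType) (f df : R -> R) (B x y : R) :
    (forall t : R, is_derive t 1 f (df t)) -> (forall t, `|df t| <= B) ->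
  `|f x - f y| <= B * `|x - y|.
Proof.
move=> dfP dfB; wlog xy : x y / x <= y.
  move=> H; have [xy|/ltW yx] := leP x y; first exact: H.
  by rewrite distrC [`|x - y|]distrC H.
have [c _ ->] : exists2 c, true & f x - f y = df c * (x - y).
  have [|z _ fz] := @MVT_segment R f df x y xy (fun z _ => dfP z).
    by apply: derivable_within_continuous => z _; exact: ex_derive.
  by exists z => //; rewrite -opprB fz -mulrN opprB.
by rewrite normrM ler_wpM2r.
Qed.

Section Cis.
Variable R : realType.

Definition cis (x : R) : CC R := (cos x +i* sin x)%C.

Lemma cisD x y : cis (x + y) = cis x * cis y.
Proof.
rewrite /cis cosD sinD; apply/eqP; rewrite eq_complex /=.
by rewrite addrC [sin x * _ + _]addrC !eqxx.
Qed.

Lemma cis0 : cis 0 = 1.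
Proof. by rewrite /cis cos0 sin0. Qed.

Lemma cis2pi : cis (pi *+ 2) = 1.
Proof. by rewrite /cis cos2pi sin2pi. Qed.

Lemma norm_cis x : `|cis x| = 1.
Proof. by rewrite [LHS]normc_def /= cos2Dsin2 sqrtr1. Qed.

Lemma cis_neq0 x : cis x != 0.
Proof. by rewrite -normr_eq0 norm_cis oner_eq0. Qed.

Lemma cisN x : cis (- x) = (cis x)^-1.
Proof. by apply: (mulIf (cis_neq0 x)); rewrite -cisD addNr cis0 mulVf ?cis_neq0. Qed.

Lemma norm_complex_le (x y : R) : `|(x +i* y)%C : CC R| <= toC R (`|x| + `|y|).
Proof.
have -> : (x +i* y)%C = toC R x + 'i%C * toC R y :> CC R by exact: complexE.
rewrite (le_trans (ler_normD _ _))// normrM.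
have -> : `|'i%C : CC R| = 1 by rewrite [LHS]normc_def /= expr0n expr1n add0r sqrtr1.
by rewrite mul1r rmorphD /= -!toC_norm.
Qed.

Lemma cis_lip x y : `|cis x - cis y| <= toC R (2 * `|x - y|).
Proof.
rewrite (le_trans (norm_complex_le _ _))// toC_le mulr_natl mulr2n lerD//.
  rewrite -[X in _ <= X]mul1r; apply: bounded_derivative_lipschitz => t.
  by rewrite normrN sin_max.
rewrite -[X in _ <= X]mul1r; apply: bounded_derivative_lipschitz => t.
exact: cos_max.
Qed.

Lemma cis_subV x : `|cis x - (cis x)^-1| = toC R (`|sin x| *+ 2).
Proof.
rewrite -cisN /cis cosN sinN.
have -> : (cos x +i* sin x)%C - (cos x +i* - sin x)%C = (0 +i* (sin x *+ 2))%C :> CC R.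
  by apply/eqP; rewrite eq_complex /= subrr opprK mulr2n !eqxx.
by rewrite [LHS]normc_def /= expr0n add0r sqrtr_sqr normrMn.
Qed.

(** By the duplication formula and [cos <= 1] the right-hand side increases with [n], and its first
    value is [4 * sin (pi / 2)]. *)
Lemma sin_dyadic_ge n : 4 <= 2 ^+ n.+2 * sin (pi *+ 2 / 2 ^+ n.+2) :> R.
Proof.
elim: n => [|n IH].
  have -> : pi *+ 2 / 2 ^+ 2 = pi / 2 :> R by field.
  by rewrite sin_pihalf mulr1 -natrX.
apply: (le_trans IH); set x := pi *+ 2 / 2 ^+ n.+3.
have -> : pi *+ 2 / 2 ^+ n.+2 = x *+ 2.
  by rewrite /x (exprS _ n.+2); field; rewrite expf_neq0.
rewrite sin_mulr2n (exprS _ n.+2) -[cos x * _ *+ 2]mulr_natl mulrCA -mulrA.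
rewrite !ler_wpM2l ?exprn_ge0//.
rewrite ler_piMl ?cos_le1// sin_ge0_pi//; apply/andP; split.
  by rewrite divr_ge0 ?exprn_ge0// mulrn_wge0 ?pi_ge0.
rewrite ler_pdivrMr ?exprn_gt0// -[leLHS]mulr_natr ler_wpM2l ?pi_ge0//.
by rewrite -natrX ler_nat (leq_exp2l 1).
Qed.

End Cis.

(** Retraction onto the unit interval. It keeps the radius bounded, so that polar coordinates become
    Lipschitz on the whole plane, as the hypothesis [phi_lip] requires. *)
Definition clamp (R : realType) (s : R) := Num.max 0 (Num.min 1 s).

Lemma clamp_itv (R : realType) (s : R) : 0 <= clamp s <= 1.
Proof. by rewrite /clamp le_max lexx ge_max ler01 ge_min lexx. Qed.

Lemma clamp_lip (R : realType) (s t : R) : `|clamp s - clamp t| <= `|s - t|.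
Proof.
rewrite ler_norml /clamp /Num.max /Num.min.
have := ler_norm (s - t); have := ler_norm (t - s); rewrite [`|t - s|]distrC.
move: (`|_|) => N h1 h2.
by case: (ltP 1 s) => ?; case: (ltP 1 t) => ?; rewrite ?ltr01; do ?[case: ltP => ?];
  apply/andP; split; lra.
Qed.

Section MeanValue.
Variables (R : realType) (f : CC R -> CC R).

Definition circle_sum (n : nat) (rho : CC R) :=
  \sum_(k < 2 ^ n) f (rho * cis (pi *+ 2 * (k%:R / 2 ^+ n))).

(* The edge sum of [f w / w] along a circle is a multiple of the plain average
   of [f] over roots of unity. *)
Lemma edges_on_circle (n : nat) (rho : CC R) : rho != 0 ->
  let p k := rho * cis (pi *+ 2 * (k%:R / 2 ^+ n)) in
  let z := cis (pi *+ 2 / 2 ^+ n : R) in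
  \sum_(k < 2 ^ n) edge (fun w => f w / w) (p k) (p k.+1)
    = (z - z^-1) * circle_sum n rho.
Proof.
move=> rho0 p z.
have p0 k : p k != 0 by rewrite mulf_neq0 ?cis_neq0.
have pS k : p k.+1 = p k * z.
  by rewrite /p /z -mulrA -cisD; congr (_ * cis _); rewrite -[k.+1%:R]natr1; ring.
(* Since [p k.+1 = p k * z], the factors [p k] cancel. The second summand telescopes to zero around
   the closed circle. *)
have e k : edge (fun w => f w / w) (p k) (p k.+1)
    = f (p k) * (z - z^-1) + (f (p k.+1) - f (p k)) * (1 - z^-1).
  rewrite /edge pS; field.
  by rewrite mulf_neq0 ?cis_neq0.
under eq_bigr do rewrite e.
rewrite big_split /= -!mulr_suml.
rewrite -(big_mkord xpredT (fun k => f (p k.+1) - f (p k))).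
rewrite telescope_sumr//.
have -> : p (2 ^ n)%N = p 0%N.
  rewrite /p natrX divff ?expf_neq0// mulr1 cis2pi mul0r mulr0 cis0//.
by rewrite subrr mul0r addr0 mulrC.
Qed.

(* [goursat] on the annulus between a small circle around [0] and the circle
   of radius [r]: the two radial sides cancel, so the averages of [f] on both
   circles agree in the limit. Differentiability at [0] is not required, which
   lets one apply this to difference quotients. *)
Theorem mean_value_le (r M : CC R) : 0 < r -> {for 0, continuous f} ->
    (forall z, 0 < `|z| <= r -> differentiable f z) ->
    (forall z, `|z| = r -> `|f z| <= M) ->
  `|f 0| <= M.
Proof.
move=> r0 cf df fM; apply/ler_addgt0Pr => e e0.
have e20 : 0 < e / 2 by rewrite divr_gt0.
have [b b0 rb] := gt0_toC r0.
have [a /andP[a0 ab] fa] : exists2 a : R, 0 < a < b &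
    forall z, `|z| <= toC R a -> `|f 0 - f z| <= e / 2.
  have /cvgrPdist_le /(_ _ e20) /nbhs_normP[d /= d0 fd] := cf.
  have [c c0 dc] := gt0_toC d0.
  exists (Num.min (b / 2) (c / 2)).
    by rewrite lt_min !divr_gt0//= gt_min ltr_pdivrMr// ltr_pMr// ltr1n.
  move=> z za; apply: fd => /=; rewrite sub0r normrN (le_lt_trans za)// dc toC_lt.
  by rewrite gt_min; apply/orP; right; rewrite ltr_pdivrMr// ltr_pMr// ltr1n.
pose cl := @clamp R; have cl01 := @clamp_itv R; have cl_lip := @clamp_lip R.
pose rho s : R := a + (b - a) * cl s.
have rho_bd s : a <= rho s <= b.
  have /andP[c0 c1] := cl01 s.
  have ba : 0 <= b - a by rewrite subr_ge0 ltW.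
  rewrite /rho lerDl mulr_ge0//=.
  by rewrite -[leRHS](subrK a) addrC lerD2r ler_piMr.
pose phi (s t : R) : CC R := toC R (rho s) * cis (pi *+ 2 * t).
(* The first [b] bounds the radial speed, the other term the angular speed, with the Lipschitz
   constant [2] of [cis_lip]. *)
pose L := toC R (b + b * (2 * (pi *+ 2))).
have bpos : 0 < b by [].
have L0 : 0 < L.
  by rewrite -(rmorph0 (toC R)) toC_lt addr_gt0// !mulr_gt0// mulrn_wgt0// pi_gt0.
have phi_lip s t s' t' : `|phi s t - phi s' t'| <= L * toC R (`|s - s'| + `|t - t'|).
  have -> : phi s t - phi s' t' = (toC R (rho s) - toC R (rho s')) * cis (pi *+ 2 * t)
     + toC R (rho s') * (cis (pi *+ 2 * t) - cis (pi *+ 2 * t')).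
    by rewrite /phi; ring.
  rewrite (le_trans (ler_normD _ _))// !normrM norm_cis mulr1 -rmorphB !toC_norm.
  rewrite (le_trans (lerD (lexx _) (ler_wpM2l _ (cis_lip _ _))))//.
    by rewrite -(rmorph0 (toC R)) toC_le.
  rewrite /L -!rmorphM /= -rmorphD toC_le.
  have -> : rho s - rho s' = (b - a) * (cl s - cl s') by rewrite /rho; ring.
  rewrite -mulrBr !normrM.
  have -> : `|b - a| = b - a by rewrite ger0_norm// subr_ge0 ltW.
  have /andP[r1 r2] := rho_bd s'.
  have -> : `|rho s'| = rho s' by rewrite ger0_norm// (le_trans _ r1)// ltW.
  have -> : `|pi *+ 2| = pi *+ 2 :> R by rewrite ger0_norm// mulrn_wge0// pi_ge0.
  have pi2_ge0 : 0 <= pi *+ 2 :> R by rewrite mulrn_wge0// pi_ge0.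
  have h1 : (b - a) * `|cl s - cl s'| <= b * `|s - s'|.
    by apply: ler_pM (cl_lip _ _); rewrite ?normr_ge0 ?subr_ge0 ?gerBl// ltW.
  have h2 : rho s' * (2 * (pi *+ 2 * `|t - t'|)) <= b * (2 * (pi *+ 2 * `|t - t'|)).
    by rewrite ler_wpM2r// !mulr_ge0// mulrn_wge0// pi_ge0.
  have h3 : 0 <= b * (2 * (pi *+ 2)) * `|s - s'|.
    exact: (mulr_ge0 (mulr_ge0 (ltW b0) (mulr_ge0 (ler0n _ _) pi2_ge0)) (normr_ge0 _)).
  have h4 : 0 <= b * `|t - t'| by rewrite !mulr_ge0// ltW.
  have -> : (b + b * (2 * (pi *+ 2))) * (`|s - s'| + `|t - t'|) =
    b * `|s - s'| + b * (2 * (pi *+ 2 * `|t - t'|)) +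
    (b * (2 * (pi *+ 2)) * `|s - s'| + b * `|t - t'|) by ring.
  by rewrite -[leLHS]addr0 lerD// ?lerD// addr_ge0.
have dh s t : 0 <= s <= 1 -> 0 <= t <= 1 ->
    differentiable (fun w => f w / w) (phi s t).
  move=> _ _; have /andP[r1 r2] := rho_bd s.
  have rp : 0 < rho s by rewrite (lt_le_trans _ r1).
  have np : `|phi s t| = toC R (rho s).
    by rewrite /phi normrM norm_cis mulr1 toC_norm gtr0_norm.
  apply: differentiableM.
    by apply: df; rewrite np -(rmorph0 (toC R)) toC_lt rp rb toC_le.
  apply: differentiableV => //.
  by rewrite -normr_eq0 np fmorph_eq0 gt_eqF.
(* Two more levels guarantee the four sample points at which [sin_dyadic_ge] starts. *)
have [n0 /(_ n0.+2)] := goursat L0 phi_lip dh e20.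
move=> /(_ _)/wrap[]; first by rewrite -addn2 leq_addr.
set n := n0.+2.
have -> : loop (fun w => f w / w) (grid phi n) 0 0 (2 ^ n) =
   (cis (pi *+ 2 / 2 ^+ n) - (cis (pi *+ 2 / 2 ^+ n))^-1) *
   (circle_sum n (toC R b) - circle_sum n (toC R a)).
  rewrite /loop !add0n.
  have -> : hsum (fun w => f w / w) (grid phi n) 0 (2 ^ n) (2 ^ n) =
     hsum (fun w => f w / w) (grid phi n) 0 0 (2 ^ n).
    apply: eq_bigr => k _; rewrite /grid /phi natrX divff ?expf_neq0//.
    by rewrite mul0r mulr0 mulr1 cis2pi cis0.
  rewrite [X in X - _]addrAC subrr add0r /vsum mulrBr.
  have a0' : toC R a != 0 by rewrite fmorph_eq0 gt_eqF.
  have b0' : toC R b != 0 by rewrite fmorph_eq0 gt_eqF.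
  rewrite -!edges_on_circle//; congr (_ - _); apply: eq_bigr => k _.
    rewrite /grid !add0n /phi natrX divff ?expf_neq0//.
    have -> : rho 1 = b by rewrite /rho /cl /clamp minxx max_r// mulr1 addrC subrK.
    by [].
  rewrite /grid !add0n /phi mul0r.
  by have -> : rho 0 = a by rewrite /rho /cl /clamp min_r// maxxx mulr0 addr0.
rewrite normrM cis_subV.
set c := toC R _; set Sb := circle_sum _ _; set Sa := circle_sum _ _ => H.
pose m : CC R := (2 ^ n)%:R.
have Sb_le : `|Sb| <= m * M.
  rewrite (le_trans (ler_norm_sum _ _ _))// (le_trans (ler_sum _ (G := fun=> M) _))//.
    move=> k _; apply: fM; rewrite normrM norm_cis mulr1 toC_norm rb gtr0_norm//.
  by rewrite sumr_const card_ord [leRHS]mulr_natl.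
have Sa_le : `|m * f 0 - Sa| <= m * (e / 2).
  have -> : m * f 0 = \sum_(k < 2 ^ n) f 0 by rewrite sumr_const card_ord mulr_natl.
  rewrite -sumrB.
  rewrite (le_trans (ler_norm_sum _ _ _))// (le_trans (ler_sum _ (G := fun=> e / 2) _))//.
    move=> k _; apply: fa; rewrite normrM norm_cis mulr1 toC_norm gtr0_norm//.
  by rewrite sumr_const card_ord [leRHS]mulr_natl.
have m0 : 0 < m by rewrite ltr0n expn_gt0.
have c0 : 0 <= c by rewrite -(rmorph0 (toC R)) toC_le mulrn_wge0.
(* The factor [c] shrinks with the mesh, but [m * c] does not; dividing by it keeps the loop error
   below [e / 2]. *)
have cm : 1 <= m * c.
  have -> : m = toC R (2 ^+ n) by rewrite /m natrX rmorphXn /= rmorph_nat.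
  rewrite -rmorphM -(rmorph1 (toC R)) toC_le mulrnAr.
  have := sin_dyadic_ge R n0; rewrite -/n => h4.
  have : 4 <= 2 ^+ n * `|sin (pi *+ 2 / 2 ^+ n)| :> R.
    by rewrite (le_trans h4)// ler_wpM2l ?exprn_ge0// ler_norm.
  by move: (_ * _) => w; rewrite mulr2n; lra.
have mc0 : 0 < m * c by rewrite (lt_le_trans _ cm).
rewrite -(ler_pM2l mc0).
have -> : m * c * `|f 0| = c * `|(m * f 0 - Sa) + Sb - (Sb - Sa)|.
  have -> : (m * f 0 - Sa) + Sb - (Sb - Sa) = m * f 0 by ring.
  by rewrite normrM (gtr0_norm m0) mulrCA mulrA.
have : c * `|m * f 0 - Sa + Sb - (Sb - Sa)| <= c * (m * (e / 2) + m * M) + e / 2.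
  rewrite (le_trans (ler_wpM2l c0 (ler_normB _ _)))// mulrDr lerD//.
  by rewrite ler_wpM2l// (le_trans (ler_normD _ _))// lerD.
move=> /le_trans; apply.
have -> : m * c * (M + e) = c * (m * (e / 2) + m * M) + (m * c) * (e / 2) by field.
by rewrite lerD2l ler_peMl// ltW.
Qed.

End MeanValue.

(** * Cauchy estimates *)

Lemma near_eq_differentiable (K : numFieldType) (V W : normedModType K)
    (f g : V -> W) (a : V) : f a = g a -> (\forall x \near a, f x = g x) ->
  differentiable f a ->
  differentiable g a /\ 'd g a = 'd f a :> (V -> W).
Proof.
move=> fga fg df; have /diff_locally /eqaddoP rf := df.
have dfc := diff_continuous df.
have H : g \o shift a = cst (g a) + 'd f a +o_ 0 id.
  apply/eqaddoP => e e0; have := rf _ e0.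
  have /nbhs0P fg' := fg; move: fg'; apply: filterS2 => h fgh.
  rewrite -![(_ + _ : _ -> _) _]/(_ + _) -![(- _ : _ -> _) _]/(- _) /=.
  by rewrite /shift /cst /= [h + a]addrC -fgh -fga [a + h]addrC.
have dg := diff_unique dfc H.
by split=> //; apply/diff_locallyP; rewrite dg; split.
Qed.

(** A quadratic remainder, unlike a mere little-o, survives a limit of functions with a uniform
    constant; this criterion then recovers differentiability of the limit. *)
Lemma quadratic_differentiable (K : numFieldType) (V W : normedModType K)
    (f : V -> W) (L : {linear V -> W}) (a : V) (d c : K) : 0 < d -> continuous L ->
    (forall h, `|h| < d -> `|f (h + a) - f a - L h| <= c * `|h| ^+ 2) ->
  differentiable f a.
Proof.
move=> d0 Lc fL.
have c0 : 0 <= `|c| + 1 by rewrite addr_ge0.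
have H : f \o shift a = cst (f a) + L +o_ 0 id.
  apply/eqaddoP => e e0; near=> h.
  rewrite -![(_ + _ : _ -> _) _]/(_ + _) -![(- _ : _ -> _) _]/(- _) /=.
  rewrite /shift /cst /= opprD addrA.
  have hd : `|h| < d by near: h; exact: nbhs0_lt.
  have he : `|h| <= e / (`|c| + 1).
    by near: h; apply: nbhs0_le; rewrite divr_gt0// ltr_wpDl.
  have fh := fL h hd; apply: (le_trans fh).
  have cr : c * `|h| ^+ 2 <= (`|c| + 1) * `|h| ^+ 2.
    have : 0 <= c * `|h| ^+ 2 by apply: le_trans fh.
    move=> ch; rewrite -[c * _]ger0_norm// normrM [`|_ ^+ 2|]ger0_norm ?exprn_ge0//.
    by rewrite ler_wpM2r ?exprn_ge0// lerDl.
  apply: (le_trans cr); rewrite expr2 mulrA ler_wpM2r//.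
  by rewrite mulrC -ler_pdivlMr// ltr_wpDl.
have dg := diff_unique Lc H.
by apply/diff_locallyP; rewrite dg; split.
Unshelve. all: by end_near. Qed.

Lemma affine_differentiable (K : numFieldType) (V : normedModType K)
  (x h : V) (s : K) : differentiable (fun s : K => x + s *: h) s.
Proof.
apply: differentiableD; first exact: differentiable_cst.
by apply: ex_diff.
Qed.

Section Cauchy.
Variables (R : realType) (W : normedModType (CC R)) (f : W -> CC R).

(** The difference quotient [q], completed at [0] by the derivative, is continuous there and
    differentiable elsewhere, so [mean_value_le] applies. The factor [2] arises because its
    numerator is a difference of two values of [f]. *)
Lemma cauchy_line (x h : W) (M : CC R) :
    (forall s : CC R, `|s| <= 1 -> differentiable f (x + s *: h)) ->
    (forall s : CC R, `|s| <= 1 -> `|f (x + s *: h)| <= M) ->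
  `|'d f x h| <= 2 * M.
Proof.
move=> df fM.
have df0 : differentiable f x by have := df 0; rewrite normr0 scale0r addr0; apply.
have fxM : `|f x| <= M by have := fM 0; rewrite normr0 scale0r addr0; apply.
pose q (s : CC R) : CC R := if s == 0 then 'd f x h else (f (x + s *: h) - f x) / s.
have -> : 'd f x h = q 0 by rewrite /q eqxx.
apply: (@mean_value_le R q 1) => //.
- change (q @ nbhs (0 : CC R) --> q 0); apply/cvgrPdist_le => e e0.
  have h0 : 0 < `|h| + 1 by rewrite ltr_wpDl.
  have eh : 0 < e / (`|h| + 1) by rewrite divr_gt0.
  have /nbhs0P/nbhs_normP[d /= d0 fd] := differentiable_remainder df0 eh.
  apply/nbhs_normP; exists (d / (`|h| + 1)) => /=; first by rewrite divr_gt0.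
  move=> s /=; rewrite sub0r normrN => sd.
  rewrite /q eqxx; case: eqP => [|/eqP s0]; first by rewrite subrr normr0 ltW.
  have sd' : `|0 - s *: h| < d.
    rewrite sub0r normrN normrZ; move: sd; rewrite ltr_pdivlMr//; apply: le_lt_trans.
    by rewrite ler_wpM2l// lerDl.
  have := fd _ sd'; rewrite [x + _ - x]addrC addKr linearZ /= normrZ => H.
  have sp : 0 < `|s| by rewrite normr_gt0.
  rewrite -(ler_pM2l sp) -normrM.
  have -> : s * ('d f x h - (f (x + s *: h) - f x) / s) =
     - (f (x + s *: h) - f x - s *: 'd f x h).
    by rewrite /GRing.scale /=; field.
  rewrite normrN; apply: (le_trans H); rewrite mulrCA ler_wpM2l//.
  by rewrite mulrAC ler_pdivrMr// ler_wpM2l ?ltW// ltrDl.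
- move=> s /andP[s0 s1].
  have s0' : s != 0 by rewrite -normr_gt0.
  apply: (@near_eq_differentiable (CC R) (CC R) (CC R) (fun s => (f (x + s *: h) - f x) / s) q s _ _ _).1.
  + by rewrite /q (negPf s0').
  + apply/nbhs_normP; exists `|s| => // t /= st; rewrite /q; case: eqP => // t0.
    by move: st; rewrite t0 subr0 ltxx.
  apply: differentiableM; last exact: differentiableV.
  apply: differentiableB; last exact: differentiable_cst.
  apply: differentiable_comp; first exact: affine_differentiable.
  exact: df.
- move=> s s1; rewrite /q ifF; last by rewrite -normr_eq0 s1 oner_eq0.
  rewrite normrM normfV s1 invr1 mulr1 (le_trans (ler_normB _ _))//.
  by rewrite mulr_natl mulr2n lerD// fM ?s1.
Qed.

Lemma cauchy_estimate (x h : W) (r M : CC R) : 0 < r ->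
    (forall y, `|y - x| <= r -> differentiable f y) ->
    (forall y, `|y - x| <= r -> `|f y| <= M) ->
  `|'d f x h| <= 2 * M / r * `|h|.
Proof.
move=> r0 df fM; have [->|h0] := eqVneq h 0.
  by rewrite linear0 !normr0 mulr0.
have hp : 0 < `|h| by rewrite normr_gt0.
pose k : CC R := r / `|h|.
have k0 : 0 < k by rewrite divr_gt0.
have near s : `|s| <= 1 -> `|x + s *: (k *: h) - x| <= r.
  move=> s1; rewrite addrC addKr 2!normrZ (gtr0_norm k0) divfK ?gt_eqF//.
  by rewrite ler_piMl// ltW.
have := @cauchy_line x (k *: h) M (fun s s1 => df _ (near s s1))
   (fun s s1 => fM _ (near s s1)).
rewrite linearZ normrZ (gtr0_norm k0) => H.
rewrite -(ler_pM2l k0) (le_trans H)// le_eqVlt; apply/orP; left; apply/eqP.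
by rewrite /k; field; rewrite !gt_eqF.
Qed.

End Cauchy.

(** The real mean value theorem fails for complex values. Instead, bisection keeps an interval whose
    increment exceeds [B + e] times its length, and differentiability at the limit point excludes
    this. *)
Lemma mean_value_inequality (R : realType) (W : normedModType (CC R))
    (f : W -> CC R) (x h : W) (B : CC R) :
    (forall t : R, 0 <= t <= 1 -> differentiable f (x + toC R t *: h)) ->
    (forall t : R, 0 <= t <= 1 -> `|'d f (x + toC R t *: h) h| <= B) ->
  `|f (x + h) - f x| <= B.
Proof.
move=> df dfB; apply/ler_addgt0Pr => e e0; apply: contrapT => nH.
pose g t := f (x + toC R t *: h).
pose bad (z : nat * nat) :=
  ~ `|g (z.2.+1%:R / 2 ^+ z.1) - g (z.2%:R / 2 ^+ z.1)| <= (B + e) / 2 ^+ z.1.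
have step z : exists d : bool, bad z -> bad (z.1.+1, z.2.*2 + d)%N.
  case: z => k i; apply: contrapT => H.
  have [b bz] : bad (k, i) /\ forall d : bool,
     `|g ((i.*2 + d).+1%:R / 2 ^+ k.+1) - g ((i.*2 + d)%:R / 2 ^+ k.+1)|
       <= (B + e) / 2 ^+ k.+1.
    split; first by apply: contrapT => nb; apply: H; exists false.
    by move=> d; apply: contrapT => nb; apply: H; exists d.
  apply: b; rewrite /bad /=.
  have e1 : i%:R / 2 ^+ k = i.*2%:R / 2 ^+ k.+1 :> R.
    by rewrite -mul2n natrM exprS; field; rewrite expf_neq0.
  have e2 : i.+1%:R / 2 ^+ k = i.*2.+2%:R / 2 ^+ k.+1 :> R.
    by rewrite -doubleS -mul2n natrM exprS; field; rewrite expf_neq0.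
  have := bz true; have := bz false; rewrite addn0 addn1 => h1 h2.
  rewrite e1 e2.
  have -> : (B + e) / 2 ^+ k = (B + e) / 2 ^+ k.+1 + (B + e) / 2 ^+ k.+1.
    by rewrite exprS; field; rewrite expf_neq0.
  by rewrite (le_trans (ler_distD (g (i.*2.+1%:R / 2 ^+ k.+1)) _ _))// lerD.
have [c cP] := choice step.
pose st := fix st k : nat * nat := if k is k'.+1 then
  ((st k').1.+1, (st k').2.*2 + c (st k'))%N else (0, 0)%N.
have stk k : (st k).1 = k by elim: k => //= k ->.
have stb k : bad (st k).
  elim: k => [|k /cP//]; rewrite /bad /= => H; apply: nH; move: H.
  by rewrite expr0 !divr1 /g rmorph0 rmorph1 scale0r scale1r addr0.
have [t tP] : exists x : R, forall k,
    ((st k).2)%:R / 2 ^+ k <= x <= ((st k).2).+1%:R / 2 ^+ k.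
  by apply: dyadic_limit => k; exists (c (st k)).
have t01 : 0 <= t <= 1 by have := tP 0%N; rewrite /= !divr1.
have B0 : 0 <= B by apply: le_trans (dfB _ t01).
have h0 : 0 < `|h| + 1 by rewrite ltr_wpDl.
have e10 : 0 < e / (`|h| + 1) by rewrite divr_gt0.
have /nbhs_normP[d /= d0 hd] := differentiable_remainder (df _ t01) e10.
have [k kd] : exists k, toC R (2 ^+ k)^-1 * (`|h| + 1) < d.
  have [r r0 dr] := gt0_toC d0; have [l l0 Ll] := gt0_toC h0.
  have [k kP] : exists k : nat, l / r < k%:R.
    exists (Num.trunc (l / r)).+1; exact: truncnS_gt.
  exists k; rewrite dr Ll -rmorphM toC_lt mulrC ltr_pdivrMr ?exprn_gt0//.
  rewrite [ltRHS]mulrC -ltr_pdivrMr//.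
  apply: (lt_trans kP); rewrite -natrX ltr_nat; exact: ltn_expl.
have := stb k; have := tP k; rewrite /bad stk; move: (st k).2 => i itP; apply.
pose q s := 'd f (x + toC R t *: h) h * toC R (s - t).
have near s : `|s - t| <= (2 ^+ k)^-1 ->
    `|g s - g t - q s| <= e * toC R `|s - t|.
  move=> sk.
  have eq1 : x + toC R s *: h - (x + toC R t *: h) = toC R (s - t) *: h.
    by rewrite opprD addrACA subrr add0r rmorphB scalerBl.
  have nrm : `|toC R (s - t) *: h| <= toC R `|s - t| * (`|h| + 1).
    by rewrite normrZ toC_norm ler_wpM2l ?lerDl// -(rmorph0 (toC R)) toC_le.
  have := hd (x + toC R s *: h); rewrite /ball_ /= distrC eq1 linearZ /= => H.
  have -> : q s = toC R (s - t) *: 'd f (x + toC R t *: h) h by rewrite /q mulrC.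
  apply: (le_trans (H _)).
    apply: (le_lt_trans nrm); apply: le_lt_trans kd.
    by rewrite ler_wpM2r ?(ltW h0)// toC_le.
  apply: (le_trans (ler_wpM2l (ltW e10) nrm)).
  by rewrite mulrCA divfK ?gt_eqF// mulrC.
have p2 : (0 : R) < 2 ^+ k by rewrite exprn_gt0.
have uv : i.+1%:R / 2 ^+ k - i%:R / 2 ^+ k = (2 ^+ k)^-1 :> R.
  by rewrite -mulrBl -natr1 addrAC subrr add0r mul1r.
move: itP uv; set u := i.+1%:R / _; set v := i%:R / _ => /andP[vt tu] uv.
(* As [t] lies between [v] and [u], its distances to them add up to the length of the interval, so
   the two remainders total at most [e] times that length. *)
have uvC : toC R (2 ^+ k)^-1 = toC R `|u - t| + toC R `|v - t|.
  rewrite -rmorphD -uv [`|v - t|]distrC !ger0_norm ?subr_ge0//=.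
  by congr (toC R _); rewrite addrA subrK.
have nu : `|u - t| <= (2 ^+ k)^-1.
  by rewrite -uv ger0_norm ?subr_ge0// lerD2l lerN2.
have nv : `|v - t| <= (2 ^+ k)^-1.
  by rewrite -uv distrC ger0_norm ?subr_ge0// lerD2r.
have -> : (B + e) / 2 ^+ k = B * toC R (2 ^+ k)^-1 + (e * toC R `|u - t| + e * toC R `|v - t|).
  rewrite -mulrDr -uvC -mulrDl fmorphV rmorphXn /= rmorph_nat //.
have -> : g u - g v = (q u - q v) + (g u - g t - q u) - (g v - g t - q v) by ring.
have quv : q u - q v = 'd f (x + toC R t *: h) h * toC R (2 ^+ k)^-1.
  by rewrite /q -mulrBr -rmorphB -uv; congr (_ * toC R _); ring.
rewrite (le_trans (ler_normB _ _))// [leRHS]addrA lerD ?near//.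
rewrite (le_trans (ler_normD _ _))// lerD ?near// quv normrM toC_norm.
rewrite [`|_^-1|]ger0_norm ?invr_ge0 ?(ltW p2)// ler_wpM2r ?dfB//.
by rewrite -(rmorph0 (toC R)) toC_le invr_ge0 ltW.
Qed.

Section Taylor.
Variables (R : realType) (W : normedModType (CC R)).
Implicit Types (f : W -> CC R) (a x h k : W) (r M : CC R).

Lemma diff_sub f g x k : differentiable f x -> differentiable g x ->
  'd (fun y => f y - g y) x k = 'd f x k - 'd g x k.
Proof. by move=> df dg; exact: (congr1 (fun u : W -> CC R => u k) (diffB df dg)). Qed.

Lemma shift_differentiable f h x : differentiable f (x + h) ->
  differentiable (fun y => f (y + h)) x.
Proof.
by move=> df; apply: differentiable_comp.
Qed.

Lemma diff_shift f h x : differentiable f (x + h) ->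
  'd (fun y => f (y + h)) x = 'd f (x + h) :> (W -> CC R).
Proof.
move=> df; rewrite (diff_comp (f := fun y => y + h) (g := f))//.
apply/funext => y /=; congr ('d f _ _).
have D : is_diff x (fun y : W => y + h) (id + 0) by exact: is_diffD.
by rewrite (@diff_val _ _ _ _ _ _ _ D) addr0.
Qed.

Lemma segment_norm_le h (t : R) : 0 <= t <= 1 -> `|toC R t *: h| <= `|h|.
Proof.
move=> /andP[t0 t1]; rewrite normrZ toC_norm ger0_norm//.
by rewrite ler_piMl// -(rmorph1 (toC R)) toC_le.
Qed.

(** A second-order bound without second derivatives: the Cauchy estimate for [f] makes [f]
    Lipschitz, the one for the difference of [f] and its translate by [h] makes the differential
    Lipschitz, and [mean_value_inequality] integrates the latter. The steps use radii up to [2 * r],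
    [3 * r] and [4 * r]. *)
Lemma taylor2 f a r M : 0 < r ->
    (forall y, `|y - a| <= 4 * r -> differentiable f y) ->
    (forall y, `|y - a| <= 4 * r -> `|f y| <= M) ->
  forall h, `|h| <= r -> `|f (a + h) - f a - 'd f a h| <= 4 * M / r ^+ 2 * `|h| ^+ 2.
Proof.
move=> r0 df fM.
have r00 : r >= 0 by exact: ltW.
have M0 : 0 <= M by apply: le_trans (fM a _); rewrite // subrr normr0 mulr_ge0.
have trans x y (p q s : CC R) : `|x - a| <= p -> `|y - x| <= q -> p + q <= s -> `|y - a| <= s.
  move=> h1 h2; apply: le_trans; rewrite [leRHS]addrC.
  by rewrite (le_trans (ler_distD x _ _))// lerD.
have lip x h : `|x - a| <= 2 * r -> `|h| <= r -> `|f (x + h) - f x| <= 2 * M / r * `|h|.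
  move=> xa hr; have seg t : 0 <= t <= 1 -> `|x + toC R t *: h - x| <= r.
    by move=> t01; rewrite addrC addKr (le_trans (segment_norm_le _ t01)).
  have i3 : 2 * r + r <= 3 * r by rewrite le_eqVlt; apply/orP; left; apply/eqP; ring.
  have i4 : 3 * r + r <= 4 * r by rewrite le_eqVlt; apply/orP; left; apply/eqP; ring.
  apply: mean_value_inequality => t t01.
    apply: df; apply: trans xa (seg _ t01) _; apply: (le_trans i3).
    by rewrite ler_wpM2r// ler_nat.
  apply: cauchy_estimate => // y yx.
    exact/df/(trans _ _ _ _ _ (trans _ _ _ _ _ xa (seg _ t01) i3) yx i4).
  exact/fM/(trans _ _ _ _ _ (trans _ _ _ _ _ xa (seg _ t01) i3) yx i4).
have dlip h k : `|h| <= r ->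
    `|'d f (a + h) k - 'd f a k| <= 2 * (2 * M / r * `|h|) / r * `|k|.
  move=> hr.
  have i2 : r + r <= 4 * r by rewrite -mulr2n -[leLHS]mulr_natl ler_wpM2r// ler_nat.
  have ahr : `|a + h - a| <= r by rewrite addrC addKr.
  have dfah : differentiable f (a + h).
    by apply: df; rewrite (le_trans ahr)// ler_peMl// ler1n.
  have dfa : differentiable f a by apply: df; rewrite subrr normr0 mulr_ge0.
  have dg : 'd (fun y => f (y + h) - f y) a k = 'd f (a + h) k - 'd f a k.
    apply: (etrans (diff_sub k (shift_differentiable dfah) dfa)).
    by congr (_ - _); exact: (congr1 (fun u : W -> CC R => u k) (diff_shift dfah)).
  rewrite -dg; apply: cauchy_estimate => // y ya.
    have hy : `|y + h - y| <= r by rewrite addrC addKr.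
    apply: differentiableB.
      exact/shift_differentiable/df/(trans _ _ _ _ _ ya hy i2).
    by apply: df; rewrite (le_trans ya)// ler_peMl// ler1n.
  by apply: lip; rewrite // (le_trans ya)// ler_peMl// ler1n.
move=> h hr.
have dfa : differentiable f a by apply: df; rewrite subrr normr0 mulr_ge0.
pose g y := f y - 'd f a y.
have -> : f (a + h) - f a - 'd f a h = g (a + h) - g a.
  by rewrite /g linearD; ring.
have dl y : differentiable ('d f a) y.
  by apply: linear_differentiable; apply: diff_continuous.
have near t : 0 <= t <= 1 -> `|toC R t *: h| <= r.
  by move=> t01; rewrite (le_trans (segment_norm_le _ t01)).
have near' t : 0 <= t <= 1 -> `|a + toC R t *: h - a| <= 4 * r.
  by move=> t01; rewrite addrC addKr (le_trans (near _ t01))// ler_peMl// ler1n.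
apply: mean_value_inequality => t t01.
  by apply: differentiableB => //; exact/df/near'.
have -> : 'd g (a + toC R t *: h) h = 'd f (a + toC R t *: h) h - 'd f a h.
  apply: (etrans (diff_sub h (df _ (near' _ t01)) (dl _))); congr (_ - _).
  exact: (congr1 (fun u : W -> CC R => u h) (diff_lin _ (diff_continuous dfa))).
rewrite (le_trans (dlip _ _ (near _ t01)))//.
have -> : 4 * M / r ^+ 2 * `|h| ^+ 2 = 2 * (2 * M / r * `|h|) / r * `|h|.
  by field; rewrite gt_eqF.
rewrite ler_wpM2r// ler_wpM2r ?invr_ge0// ler_wpM2l// ler_wpM2l ?segment_norm_le//.
by rewrite mulr_ge0 ?invr_ge0// mulr_ge0.
Qed.

End Taylor.

(** * Derivatives of holomorphic functions are holomorphic *)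

Lemma ler_addinvn (R : realType) (x y c : CC R) : 0 <= c ->
  (forall n, x <= y + c / n.+1%:R) -> x <= y.
Proof.
move=> c0 H; apply/ler_addgt0Pr => e e0.
have [r r0 er] := gt0_toC e0; have [k k0 ck] := ge0_toC c0.
pose n := Num.trunc (k / r).
apply: (le_trans (H n)); rewrite lerD2l er ck.
have -> : toC R k / n.+1%:R = toC R (k / n.+1%:R).
  by rewrite fmorph_div rmorph_nat.
rewrite toC_le ler_pdivrMr// mulrC -ler_pdivrMr// ltW// truncnS_gt //.
Qed.

Lemma eq0_le_invn (R : realType) (x c : CC R) : 0 <= c ->
  (forall n, `|x| <= c / n.+1%:R) -> x = 0.
Proof.
move=> c0 H; apply/eqP; rewrite -normr_le0.
by apply: (ler_addinvn c0) => n; rewrite add0r.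
Qed.

(** Each [u n + k / n.+1%:R] is an upper bound of all [u m - k / m.+1%:R], so the supremum of the
    latter is a limit with an explicit rate. *)
Lemma harmonic_cauchy_real (R : realType) (u : nat -> R) (k : R) :
    (forall n m, `|u n - u m| <= k / n.+1%:R + k / m.+1%:R) ->
  exists l, forall n, `|u n - l| <= k / n.+1%:R.
Proof.
move=> H; pose A := range (fun n => u n - k / n.+1%:R).
have ub n : ubound A (u n + k / n.+1%:R).
  move=> _ [m _ <-]; have := H m n; rewrite ler_norml => /andP[_] h; by rewrite lerBlDr -addrA [_ / _ + _]addrC -lerBlDl.
exists (sup A) => n.
have h1 : u n - k / n.+1%:R <= sup A.
  by apply: ub_le_sup; [exists (u 0%N + k / 1%:R); exact: ub|exists n].
have h2 : sup A <= u n + k / n.+1%:R.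
  by apply: ge_sup; [exists (u 0%N - k / 1%:R); exists 0%N|exact: ub].
move: h1 h2; move: (k / _) (sup A) (u n) => e l v h1 h2.
by rewrite ler_norml; apply/andP; split; lra.
Qed.

Lemma harmonic_cauchy (R : realType) (u : nat -> CC R) (K : CC R) :
    (forall n m, `|u n - u m| <= K / n.+1%:R + K / m.+1%:R) ->
  exists l, forall n, `|u n - l| <= 2 * K / n.+1%:R.
Proof.
move=> H.
have K0 : 0 <= K.
  have := H 0%N 0%N; rewrite subrr normr0 divr1 -mulr2n pmulrn_lge0//.
have [k k0 Kk] := ge0_toC K0.
have e n : K / n.+1%:R = toC R (k / n.+1%:R) by rewrite Kk fmorph_div rmorph_nat.
have [a aP] : exists a, forall n, `|complex.Re (u n) - a| <= k / n.+1%:R.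
  apply: harmonic_cauchy_real => n m; rewrite -toC_le rmorphD /= -!e.
  apply: le_trans (H n m); have := Re_le (u n - u m).
  by case: (u n) => ? ?; case: (u m) => ? ?.
have [b bP] : exists b, forall n, `|complex.Im (u n) - b| <= k / n.+1%:R.
  apply: harmonic_cauchy_real => n m; rewrite -toC_le rmorphD /= -!e.
  apply: le_trans (H n m); have := Im_le (u n - u m).
  by case: (u n) => ? ?; case: (u m) => ? ?.
exists (a +i* b)%C => n.
have -> : u n - (a +i* b)%C = ((complex.Re (u n) - a) +i* (complex.Im (u n) - b))%C.
  by case: (u n).
rewrite (le_trans (norm_complex_le _ _))// -mulrA mulr_natl mulr2n e -rmorphD toC_le.
by rewrite lerD.
Qed.

Section Core.
Variables (R : realType) (W : normedModType (CC R)).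
Implicit Types (f : W -> CC R) (a b x h k : W) (r M : CC R).

Lemma bounded_linear_cts (L : {linear W -> CC R}) (c : CC R) : 0 <= c ->
  (forall h, `|L h| <= c * `|h|) -> continuous L.
Proof.
move=> c0 Lc x; change (L @ nbhs x --> L x); apply/cvgrPdist_le => e e0.
have c1 : 0 < c + 1 by rewrite ltr_wpDl.
apply/nbhs_normP; exists (e / (c + 1)) => /=; first by rewrite divr_gt0.
move=> y /= xy; rewrite -linearB (le_trans (Lc _))//.
apply: (le_trans (ler_wpM2r (normr_ge0 _) (_ : c <= c + 1))); first by rewrite lerDl.
by rewrite mulrC -ler_pdivlMr// ltW.
Qed.

(* On a neighborhood of [a] the difference quotients [G n] of [f] along [b] are
   holomorphic, uniformly bounded, and converge uniformly to ['D_b f]; the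
   Cauchy estimates then make their differentials at [a] converge as well, and
   [taylor2] passes to the limit. *)
Theorem derive_differentiable f a b :
  (\forall x \near a, differentiable f x) -> differentiable ('D_b f) a.
Proof.
move=> nf.
have cf : {for a, continuous f} by apply: differentiable_continuous; exact: nbhs_singleton nf.
have nb : \forall x \near a, `|f x| <= `|f a| + 1.
  have /cvgrPdist_le /(_ 1 ltr01) := cf; apply: filterS => x fx.
  rewrite -[f x](subrK (f a)) (le_trans (ler_normD _ _))// addrC lerD2l.
  by rewrite distrC.
have /nbhs_normP[d /= d0 dP] : \forall x \near a, differentiable f x /\ `|f x| <= `|f a| + 1.
  by apply: filterS2 nf nb => x.
(* [taylor2] needs radius [4 * r] for the [G n] around [a], and again for [f] around each such
   point: [8 * r] must stay below [d]. *)
pose M := `|f a| + 1; pose r := d / 10.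
have r0 : 0 < r by rewrite divr_gt0.
have r00 : 0 <= r by exact: ltW.
have M0 : 0 <= M by rewrite addr_ge0.
have r8 : 8 * r < d.
  by rewrite /r mulrA ltr_pdivrMr// mulrC ltr_pM2l// ltr_nat.
have df x : `|x - a| <= 8 * r -> differentiable f x.
  by move=> xa; apply: (dP x _).1; rewrite /ball_ /= distrC (le_lt_trans xa).
have fM x : `|x - a| <= 8 * r -> `|f x| <= M.
  by move=> xa; apply: (dP x _).2; rewrite /ball_ /= distrC (le_lt_trans xa).
have trans x y (p q s : CC R) : `|x - a| <= p -> `|y - x| <= q -> p + q <= s -> `|y - a| <= s.
  move=> h1 h2; apply: le_trans; rewrite [leRHS]addrC.
  by rewrite (le_trans (ler_distD x _ _))// lerD.
have i8 : 4 * r + 4 * r <= 8 * r by rewrite le_eqVlt; apply/orP; left; apply/eqP; ring.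
have i41 : r <= 4 * r by rewrite ler_peMl// ler1n.
have i48 : 4 * r <= 8 * r by rewrite ler_wpM2r// ler_nat.
have aa p : 0 <= p -> `|a - a| <= p by rewrite subrr normr0.
have b1 : 0 < `|b| + 1 by rewrite ltr_wpDl.
pose tau := r / (`|b| + 1).
have tau0 : 0 < tau by rewrite divr_gt0.
pose t n : CC R := tau / n.+1%:R.
have t0 n : 0 < t n by rewrite divr_gt0.
have tb n : `|t n *: b| <= r.
  have tn : t n <= tau by rewrite ler_pdivrMr// ler_peMr ?ler1n// ltW.
  rewrite normrZ gtr0_norm// (le_trans (ler_wpM2r _ tn))//.
  by rewrite /tau mulrAC ler_pdivrMr// ler_wpM2l// lerDl.
pose T x := 'd f x b.
(* The remainder of [taylor2] for the step [t n *: b], divided by [t n], keeps one factor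
   [t n = tau / n.+1%:R]. *)
pose K := 4 * M / r ^+ 2 * tau * `|b| ^+ 2.
have K0 : 0 <= K by rewrite !mulr_ge0 ?invr_ge0 ?exprn_ge0// ltW.
pose G n x := (f (x + t n *: b) - f x) * (t n)^-1.
have GT n x : `|x - a| <= 4 * r -> `|G n x - T x| <= K / n.+1%:R.
  move=> xa.
  have H : `|f (x + t n *: b) - f x - 'd f x (t n *: b)|
     <= 4 * M / r ^+ 2 * `|t n *: b| ^+ 2.
    apply: (@taylor2 _ _ f x r M r0 _ _ (t n *: b) (tb n)) => y yx.
      exact: (df _ (trans _ _ _ _ _ xa yx i8)).
    exact: (fM _ (trans _ _ _ _ _ xa yx i8)).
  rewrite -(ler_pM2l (t0 n)) -{1}(gtr0_norm (t0 n)) -normrM.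
  have -> : t n * (G n x - T x) = f (x + t n *: b) - f x - 'd f x (t n *: b).
    by rewrite linearZ /= /GRing.scale /= /G /T; field; rewrite gt_eqF.
  apply: (le_trans H); rewrite normrZ gtr0_norm// le_eqVlt; apply/orP; left; apply/eqP.
  by rewrite /K /t; field; rewrite gt_eqF//= gt_eqF.
pose M' := 2 * M / r * `|b| + K.
have TM x : `|x - a| <= 4 * r -> `|T x| <= 2 * M / r * `|b|.
  move=> xa; rewrite /T; apply: (cauchy_estimate (f := f) (x := x) b r0) => y yx.
    exact: (df _ (trans _ _ _ _ _ xa (le_trans yx i41) i8)).
  exact: (fM _ (trans _ _ _ _ _ xa (le_trans yx i41) i8)).
have GM n x : `|x - a| <= 4 * r -> `|G n x| <= M'.
  move=> xa; rewrite -(subrK (T x) (G n x)) (le_trans (ler_normD _ _))// addrC.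
  rewrite lerD ?TM// (le_trans (GT _ _ xa))// ler_pdivrMr// ler_peMr//.
  by rewrite ler1n.
have dG n x : `|x - a| <= 4 * r -> differentiable (G n) x.
  move=> xa; apply: differentiableM; last exact: differentiable_cst.
  apply: differentiableB; last by apply: df; apply: le_trans i48.
  apply: shift_differentiable; apply: df.
  by apply: (trans _ _ _ _ _ xa _ i8); rewrite addrC addKr (le_trans (tb n)).
pose K2 := 2 * K / r.
have K20 : 0 <= K2 by apply: divr_ge0 => //; exact: mulr_ge0.
have M'0 : 0 <= M' by apply: addr_ge0 => //; rewrite mulr_ge0// divr_ge0// mulr_ge0.
have C0 h : 0 <= 2 * (K2 * `|h|) by apply: mulr_ge0 => //; exact: mulr_ge0.
(* Uniform closeness of [G n] and [G m] passes to their differentials at [a]. The limits are taken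
   for each [h] separately, so linearity of [L] remains to be shown. *)
have ex_lim h : exists l, forall n, `|'d (G n) a h - l| <= 2 * (K2 * `|h|) / n.+1%:R.
  apply: harmonic_cauchy => n m.
  have a4 : `|a - a| <= 4 * r by rewrite aa// mulr_ge0.
  rewrite -(diff_sub h (dG n a a4) (dG m a a4)).
  have -> : K2 * `|h| / n.+1%:R + K2 * `|h| / m.+1%:R =
      2 * (K / n.+1%:R + K / m.+1%:R) / r * `|h|.
    by rewrite /K2; field; rewrite ?gt_eqF//= ?pnatr_eq0.
  apply: (@cauchy_estimate _ _ (fun y => G n y - G m y) a h r _ r0) => y ya.
    by apply: differentiableB; apply: dG; apply: le_trans i41.
  have y4 : `|y - a| <= 4 * r by apply: le_trans i41.
  rewrite (le_trans (ler_distD (T y) _ _))// lerD ?GT//.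
  by rewrite distrC GT.
have [L LP] := choice ex_lim.
have dGM n h : `|'d (G n) a h| <= 2 * M' / r * `|h|.
  apply: (@cauchy_estimate _ _ (G n) a h r _ r0) => y ya; [apply: dG|apply: GM]; exact: le_trans i41.
have Llin : linear L.
  move=> c h k; apply/eqP; rewrite -subr_eq0; apply/eqP.
  pose C := 2 * (K2 * `|c *: h + k|) + (`|c| * (2 * (K2 * `|h|)) + 2 * (K2 * `|k|)).
  apply: (@eq0_le_invn _ _ C).
    by apply: addr_ge0 => //; apply: addr_ge0 => //; exact: mulr_ge0.
  move=> n; have -> : L (c *: h + k) - (c *: L h + L k) =
     - ('d (G n) a (c *: h + k) - L (c *: h + k)) + (c * ('d (G n) a h - L h) + ('d (G n) a k - L k)).
    rewrite (linearP ('d (G n) a)) /= /GRing.scale /=; ring.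
  rewrite /C mulrDl (le_trans (ler_normD _ _))// normrN lerD// mulrDl.
  by rewrite (le_trans (ler_normD _ _))// lerD// normrM -mulrA ler_wpM2l.
pose Lm := GRing.isLinear.Build _ _ _ _ _ Llin.
pose LL : {linear W -> CC R} := HB.pack L Lm.
have Lcts : continuous LL.
  apply: (@bounded_linear_cts _ (2 * M' / r + 2 * K2)).
    by apply: addr_ge0; [apply: divr_ge0|]; rewrite // mulr_ge0.
  move=> h; rewrite -[LL h](subrK ('d (G 0%N) a h)) addrC mulrDl.
  rewrite (le_trans (ler_normD _ _))// lerD// distrC (le_trans (LP h 0%N))//.
  by rewrite divr1 mulrA.
apply: (quadratic_differentiable (L := LL) (d := r) (c := 4 * M' / r ^+ 2)) => // h hr.
have hr' := ltW hr; rewrite [h + a]addrC.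
have a8 : `|a - a| <= 8 * r by rewrite aa// mulr_ge0.
have ah : `|a + h - a| <= r by rewrite addrC addKr.
have ah4 := le_trans ah i41.
have a4 : `|a - a| <= 4 * r by rewrite aa// mulr_ge0.
rewrite !deriveE; [|exact: df|exact: df (le_trans ah4 i48)].
apply: (@ler_addinvn _ _ _ (K + K + 2 * (K2 * `|h|))).
  by apply: addr_ge0 => //; exact: addr_ge0.
move=> n; rewrite -/(T (a + h)) -/(T a).
(* The constant [M'] is the same for all [n], while the other three terms of the decomposition are
   of order [1 / n.+1%:R]. *)
have H := taylor2 r0 (fun y => @dG n y) (fun y => @GM n y) hr'.
have -> : T (a + h) - T a - LL h = (G n (a + h) - G n a - 'd (G n) a h)
   + (- (G n (a + h) - T (a + h)) + (G n a - T a) + ('d (G n) a h - L h)).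
  by rewrite -[LL h]/(L h); ring.
rewrite (le_trans (ler_normD _ _))// lerD// mulrDl [(K + K) / _]mulrDl.
rewrite (le_trans (ler_normD _ _))// lerD//.
by rewrite (le_trans (ler_normD _ _))// lerD// ?normrN ?GT.
Qed.

End Core.

(** * Complex powers on the right half-plane *)

Lemma is_derive_remainder (K : numFieldType) (f : K -> K) (z D e : K) :
    is_derive z 1 f D -> 0 < e ->
  \forall w \near z, `|f w - f z - D * (w - z)| <= e * `|w - z|.
Proof.
move=> [/derivable1_diffP df fD] e0.
have := differentiable_remainder df e0; apply: filterS => w.
suff -> : 'd f z (w - z) = D * (w - z) by [].
by rewrite diff1E// derive1E fD mulrC.
Qed.

Lemma remainder_is_derive (K : numFieldType) (f : K -> K) (z D : K) :
    (forall e, 0 < e -> \forall w \near z, `|f w - f z - D * (w - z)| <= e * `|w - z|) ->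
  is_derive z 1 f D.
Proof.
move=> H.
have : (fun h : K => h^-1 *: ((f \o shift z) (h *: 1) - f z)) @ 0^' --> D.
  apply/cvgrPdist_le => e e0.
  have /nbhs0P := H e e0; rewrite near_withinE.
  apply: filterS => h + h0; rewrite [z + h]addrC addrK => fh.
  have hp : 0 < `|h| by rewrite normr_gt0.
  have -> : D - h^-1 *: ((f \o shift z) (h *: 1) - f z)
      = - (h^-1 * (f (h + z) - f z - D * h)).
    by rewrite /= /shift /GRing.scale /= mulr1; field.
  by rewrite normrN normrM normfV ler_pdivrMl// [leRHS]mulrC.
move=> c; apply: DeriveDef; first by apply/cvg_ex; exists D.
exact/cvg_lim.
Qed.

(** Continuity of [g] brings [g w] to where [f] is nearly linear; as [D] is nonzero, this first
    bounds [g w - g z] by a multiple of [w - z], and then gives the derivative. *)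
Lemma inverse_is_derive (K : numFieldType) (f g : K -> K) (z D : K) :
    (\forall w \near z, f (g w) = w) -> {for z, continuous g} ->
    D != 0 -> is_derive (g z) 1 f D -> is_derive z 1 g D^-1.
Proof.
move=> fg cg D0 fD; apply: remainder_is_derive => e e0.
have Dp : 0 < `|D| by rewrite normr_gt0.
(* For [u > 0], [u / (u + 1)] is below both [1] and [u]; so [e1] meets the two bounds [e1D] and
   [e1e] without a case distinction. *)
pose e1 := `|D| / 2 * (e * `|D| / (e * `|D| + 1)).
have eD : 0 < e * `|D| by rewrite mulr_gt0.
have eD1 : 0 < e * `|D| + 1 by rewrite addr_gt0.
have e10 : 0 < e1 by rewrite /e1 mulr_gt0// divr_gt0.
have e1D : e1 <= `|D| / 2.
  by rewrite /e1 ler_piMr ?divr_ge0// ler_pdivrMr// mul1r lerDl.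
have e1e : e1 <= `|D| / 2 * (e * `|D|).
  by rewrite /e1 ler_wpM2l ?divr_ge0// ler_pdivrMr// ler_peMr ?lerDr // ltW.
have := cg _ (is_derive_remainder fD e10); rewrite near_simpl /=.
have fgz := nbhs_singleton fg.
move: fg; apply: filterS2 => w fgw /=; rewrite fgw fgz => H.
set k := g w - g z in H *; set h := w - z in H *.
have kh : `|k| <= 2 / `|D| * `|h|.
  have h1 : `|D| * `|k| <= `|h| + e1 * `|k|.
    rewrite -normrM; have -> : D * k = h - (h - D * k) by ring.
    by rewrite (le_trans (ler_normB _ _))// lerD.
  have h2 : `|D| * `|k| <= `|h| + `|D| / 2 * `|k|.
    by rewrite (le_trans h1)// lerD2l ler_wpM2r.
  have h3 : `|D| / 2 * `|k| <= `|h|.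
    rewrite -(lerD2r (`|D| / 2 * `|k|)) (le_trans _ h2)//.
    by rewrite -mulrDl -splitr.
  rewrite mulrAC ler_pdivlMr// mulrC.
  have : 2 * (`|D| / 2 * `|k|) <= 2 * `|h| by rewrite ler_wpM2l.
  by rewrite mulrA [2 * _]mulrC divfK// pnatr_eq0.
rewrite -(ler_pM2l Dp) -normrM -normrN.
have -> : - (D * (k - D^-1 * h)) = h - D * k by field.
apply: (le_trans H); apply: (le_trans (ler_wpM2l (ltW e10) kh)).
apply: (le_trans (ler_wpM2r _ e1e)); first by rewrite mulr_ge0// divr_ge0.
rewrite le_eqVlt; apply/orP; left; apply/eqP; field.
by rewrite gt_eqF.
Qed.

Lemma is_derive_cmul (K : numFieldType) (f : K -> K) (z c D : K) :
  is_derive z 1 f D -> is_derive z 1 (fun w => c * f w) (c * D).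
Proof.
move=> fD; apply: remainder_is_derive => e e0.
have c1 : 0 < `|c| + 1 by rewrite ltr_wpDl.
have := is_derive_remainder fD (divr_gt0 e0 c1); apply: filterS => w H.
have -> : c * f w - c * f z - c * D * (w - z) = c * (f w - f z - D * (w - z)) by ring.
rewrite normrM (le_trans (ler_wpM2l (normr_ge0 _) H))// mulrA ler_wpM2r//.
by rewrite mulrCA ler_piMr ?(ltW e0)// ler_pdivrMr// mul1r lerDl.
Qed.

Lemma is_derive_diff (K : numFieldType) (f : K -> K) (z D h : K) :
  is_derive z 1 f D -> 'd f z h = D * h.
Proof.
move=> [/derivable1_diffP df fD].
apply: (etrans (congr1 (fun u : K -> K => u h) (diff1E df))).
by rewrite derive1E fD mulrC.
Qed.

Section ComplexPower.
Variable R : realType.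
Implicit Types (z w : CC R) (x y lam : R).

Lemma ReB z w : complex.Re (z - w) = complex.Re z - complex.Re w.
Proof. by case: z; case: w. Qed.

Lemma ImB z w : complex.Im (z - w) = complex.Im z - complex.Im w.
Proof. by case: z; case: w. Qed.

Lemma continuous_Re : continuous (@complex.Re R : CC R -> R).
Proof.
move=> z; change ((@complex.Re R : CC R -> R) @ nbhs z --> complex.Re z).
apply/cvgrPdist_lt => e e0; apply/nbhs_normP; exists (toC R e) => /=.
  by rewrite -(rmorph0 (toC R)) toC_lt.
by move=> w /= zw; rewrite -ReB -toC_lt (le_lt_trans (Re_le _)).
Qed.

Lemma continuous_Im : continuous (@complex.Im R : CC R -> R).
Proof.
move=> z; change ((@complex.Im R : CC R -> R) @ nbhs z --> complex.Im z).
apply/cvgrPdist_lt => e e0; apply/nbhs_normP; exists (toC R e) => /=.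
  by rewrite -(rmorph0 (toC R)) toC_lt.
by move=> w /= zw; rewrite -ImB -toC_lt (le_lt_trans (Im_le _)).
Qed.

Lemma continuous_Complex (T : topologicalType) (f g : T -> R) (t : T) :
  {for t, continuous f} -> {for t, continuous g} ->
  {for t, continuous (fun s => (f s +i* g s)%C : CC R)}.
Proof.
move=> cf cg; change ((fun s => (f s +i* g s)%C : CC R) @ nbhs t --> ((f t +i* g t)%C : CC R)).
apply/cvgrPdist_le => _ /gt0_toC[e e0 ->].
have e2 : 0 < e / 2 by rewrite divr_gt0.
have /cvgrPdist_le /(_ _ e2) := cf; have /cvgrPdist_le /(_ _ e2) := cg.
apply: filterS2 => s hg hf.
rewrite (le_trans (norm_complex_le (f t - f s) (g t - g s)))// toC_le.
by rewrite [leRHS]splitr lerD.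
Qed.

Definition cexp z : CC R := toC R (expR (complex.Re z)) * cis (complex.Im z).

(* Principal branch on the right half-plane, where [atan (Im z / Re z)] is the
   argument of [z]. *)
Definition clog z : CC R :=
  (ln (Num.sqrt (complex.Re z ^+ 2 + complex.Im z ^+ 2))
    +i* atan (complex.Im z / complex.Re z))%C.

Definition cpow lam z : CC R := cexp (toC R lam * clog z).

Lemma cexpD z w : cexp (z + w) = cexp z * cexp w.
Proof.
case: z w => a b [c d]; rewrite /cexp /= expRD cisD rmorphM /=; ring.
Qed.

Lemma cexp0 : cexp 0 = 1.
Proof. by rewrite /cexp /= expR0 cis0 rmorph1 mulr1. Qed.

Lemma cexp_neq0 z : cexp z != 0.
Proof. by rewrite mulf_neq0 ?cis_neq0// fmorph_eq0 gt_eqF// expR_gt0. Qed.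

Lemma clogK z : 0 < complex.Re z -> cexp (clog z) = z.
Proof.
case: z => x y /= x0; rewrite /cexp /clog /=.
have n0 : 0 < Num.sqrt (x ^+ 2 + y ^+ 2).
  by rewrite sqrtr_gt0 ltr_wpDr ?sqr_ge0// exprn_gt0.
rewrite lnK ?posrE//.
have E : Num.sqrt (x ^+ 2 + y ^+ 2) = x * Num.sqrt (1 + (y / x) ^+ 2).
  rewrite -{2}(ger0_norm (ltW x0)) -sqrtr_sqr -sqrtrM ?sqr_ge0//.
  by congr (Num.sqrt _); field; rewrite gt_eqF.
have c0 : 0 < cos (atan (y / x)).
  by rewrite cos_gt0_pihalf// atan_gtNpi2 atan_ltpi2.
have xc : Num.sqrt (x ^+ 2 + y ^+ 2) * cos (atan (y / x)) = x.
  by rewrite cos_atan E mulfK// gt_eqF// sqrtr_gt0 ltr_pwDl// sqr_ge0.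
have ys : Num.sqrt (x ^+ 2 + y ^+ 2) * sin (atan (y / x)) = y.
  have -> : sin (atan (y / x)) = y / x * cos (atan (y / x)).
    by rewrite -{2}(atanK (y / x)) /tan divfK// gt_eqF.
  by rewrite mulrCA xc divfK// gt_eqF.
by rewrite /cis; apply/eqP; rewrite eq_complex /= !mul0r subr0 addr0 xc ys !eqxx.
Qed.

Lemma cexp_real x : cexp (toC R x) = toC R (expR x).
Proof. by rewrite /cexp /= cis0 mulr1. Qed.

Lemma clog_real x : 0 < x -> clog (toC R x) = toC R (ln x).
Proof.
move=> x0; rewrite /clog /= mul0r atan0 expr0n addr0 sqrtr_sqr ger0_norm//.
exact: ltW.
Qed.

Lemma cpow_real lam x : 0 < x -> cpow lam (toC R x) = toC R (x `^ lam).
Proof.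
move=> x0; rewrite /cpow clog_real// -rmorphM cexp_real /powR gt_eqF//.
Qed.

Lemma is_derive_cexp0 : is_derive (0 : CC R) 1 cexp 1.
Proof.
apply: remainder_is_derive => _ /gt0_toC[e e0 ->].
(* The three errors below add up to [6 * d * n]; the bound [d <= 1] serves to keep [1 + x] below [2]
   in norm. *)
pose d := Num.min (e / 8) 1.
have d0 : 0 < d by rewrite lt_min ltr01 divr_gt0.
have de : d <= e / 8 by rewrite ge_min lexx.
have d1 : d <= 1 by rewrite ge_min lexx orbT.
clearbody d.
have rem (f : R -> R) D : is_derive (0 : R) 1 f D -> exists2 r, 0 < r &
    forall x, `|x| < r -> `|f x - f 0 - D * x| <= d * `|x|.
  move=> /is_derive_remainder /(_ d0) /nbhs_normP[r /= r0 H]; exists r => // x xr.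
  by have := H x; rewrite /= /ball_ /= distrC !subr0; apply.
have [r1 r10 H1] := rem _ _ (is_derive_expR 0).
have [r2 r20 H2] := rem _ _ (is_derive_cos 0).
have [r3 r30 H3] := rem _ _ (is_derive_sin 0).
pose r := Num.min (Num.min r1 r2) (Num.min r3 d).
have r0 : 0 < r by rewrite !lt_min r10 r20 r30.
apply/nbhs_normP; exists (toC R r) => /=; first by rewrite -(rmorph0 (toC R)) toC_lt.
move=> h /=; rewrite sub0r normrN subr0 mul1r cexp0 => hr.
have [n n0 hn] := ge0_toC (normr_ge0 h).
have := Re_le h; have := Im_le h; rewrite hn !toC_le; move: hr; rewrite hn toC_lt.
rewrite -rmorphM; case: h {hn} => x y /= nr yn xn.
have [xr yr] : `|x| < r /\ `|y| < r by rewrite !(le_lt_trans _ nr).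
move: nr xr yr; rewrite !lt_min => /andP[_ /andP[_ nd]].
move=> /andP[/andP[/H1 h1 _] _] /andP[/andP[_ /H2 h2] /andP[/H3 h3 _]].
rewrite expR0 mul1r in h1; rewrite cos0 sin0 oppr0 mul0r subr0 in h2.
rewrite sin0 cos0 mul1r subr0 in h3.
(* The remainders of [expR] and of [cis] are separated; the last term is the product of their linear
   parts. *)
have -> : cexp (x +i* y)%C - 1 - (x +i* y)%C =
  toC R (expR x - 1 - x) * cis y + toC R (1 + x) * ((cos y - 1) +i* (sin y - y))%C
   + (0 +i* (x * y))%C.
  apply/eqP; rewrite eq_complex /=; apply/andP; split; apply/eqP; ring.
have x1 : `|x| < 1 by rewrite (le_lt_trans xn)// (lt_le_trans nd).
have B1 : `|toC R (expR x - 1 - x) * cis y| <= toC R (d * n).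
  by rewrite normrM norm_cis mulr1 toC_norm toC_le (le_trans h1)// ler_wpM2l// ltW.
have B2 : `|toC R (1 + x) * ((cos y - 1) +i* (sin y - y))%C| <= toC R (4 * d * n).
  rewrite normrM toC_norm.
  have -> : 4 * d * n = 2 * (d * n + d * n) by ring.
  rewrite rmorphM; apply: ler_pM => //.
  - by rewrite -(rmorph0 (toC R)) toC_le.
  - rewrite toC_le (le_trans (ler_normD _ _))// normr1.
    by rewrite -[leRHS]/(1 + 1) lerD2l ltW.
  - rewrite (le_trans (norm_complex_le _ _))// toC_le lerD//.
      by rewrite (le_trans h2)// ler_wpM2l// ltW.
    by rewrite (le_trans h3)// ler_wpM2l// ltW.
have B3 : `|(0 +i* (x * y))%C : CC R| <= toC R (d * n).
  rewrite (le_trans (norm_complex_le _ _))// toC_le normr0 add0r normrM.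
  by rewrite ler_pM// (le_trans xn)// ltW.
rewrite (le_trans (ler_normD _ _))// (le_trans (lerD (ler_normD _ _) (lexx _)))//.
rewrite (le_trans (lerD (lerD B1 B2) B3))// -!rmorphD toC_le.
have -> : d * n + 4 * d * n + d * n = 6 * d * n by ring.
rewrite ler_wpM2r//.
move: e0 de; clear; lra.
Qed.

Lemma is_derive_cexp z : is_derive z 1 cexp (cexp z).
Proof.
apply: remainder_is_derive => e e0.
have zp : 0 < `|cexp z| by rewrite normr_gt0 cexp_neq0.
have := is_derive_remainder is_derive_cexp0 (divr_gt0 e0 zp).
move=> /nbhs_normP[d /= d0 H]; apply/nbhs_normP; exists d => // w /= zw.
have := H (w - z); rewrite /= sub0r normrN subr0 mul1r cexp0 distrC => {}H.
have -> : cexp w = cexp z * cexp (w - z) by rewrite -cexpD addrC subrK.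
have -> : cexp z * cexp (w - z) - cexp z - cexp z * (w - z)
  = cexp z * (cexp (w - z) - 1 - (w - z)) by ring.
by rewrite normrM -ler_pdivlMl// mulrA [_^-1 * e]mulrC H.
Qed.

Lemma near_Re_gt0 z : 0 < complex.Re z -> \forall w \near z, 0 < complex.Re w.
Proof.
by move=> z0; exact: (cvgr_gt _ (@continuous_Re z) _ z0).
Qed.

Lemma continuous_clog z : 0 < complex.Re z -> {for z, continuous clog}.
Proof.
move=> z0; apply: continuous_Complex.
  apply: (@continuous_comp _ _ _ (fun w : CC R => Num.sqrt (complex.Re w ^+ 2 + complex.Im w ^+ 2)) (@ln R)).
    apply: (@continuous_comp _ _ _ (fun w : CC R => complex.Re w ^+ 2 + complex.Im w ^+ 2) Num.sqrt); last exact: sqrt_continuous.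
    have sq (g : CC R -> R) : continuous g -> {for z, continuous (fun w => g w ^+ 2)}.
      move=> cg; apply: (@continuous_comp _ _ _ g (fun t : R => t ^+ 2)).
        exact: cg.
      exact: exprn_continuous.
    exact: (cvgD (sq _ continuous_Re) (sq _ continuous_Im)).
  apply: continuous_ln; rewrite sqrtr_gt0 ltr_wpDr ?sqr_ge0//.
  by rewrite exprn_gt0.
apply: (@continuous_comp _ _ _ (fun w : CC R => complex.Im w / complex.Re w) (@atan R)); last exact: continuous_atan.
have z0' : complex.Re z != 0 by rewrite gt_eqF.
exact: (cvgM (@continuous_Im z) (cvgV z0' (@continuous_Re z))).
Qed.

Lemma is_derive_clog z : 0 < complex.Re z -> is_derive z 1 clog z^-1.
Proof.
move=> z0; have z0' : z != 0.
  by apply: contraTneq z0 => ->; rewrite ltxx.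
apply: (inverse_is_derive (f := cexp)) => //.
- by have := near_Re_gt0 z0; apply: filterS => w; exact: clogK.
- exact: continuous_clog.
- by rewrite -{2}(clogK z0); exact: is_derive_cexp.
Qed.

Lemma differentiable_cpow lam z : 0 < complex.Re z -> differentiable (cpow lam) z.
Proof.
move=> z0; apply: differentiable_comp.
  apply: differentiableM; first exact: differentiable_cst.
  by apply/derivable1_diffP; have [] := is_derive_clog z0.
by apply/derivable1_diffP; have [] := is_derive_cexp (toC R lam * clog z).
Qed.

Lemma diff_cpow lam z h : 0 < complex.Re z ->
  'd (cpow lam) z h = toC R lam * cpow lam z / z * h.
Proof.
move=> z0.
have dm := is_derive_cmul (toC R lam) (is_derive_clog z0).
have de := is_derive_cexp (toC R lam * clog z).
have [/derivable1_diffP dm' _] := dm; have [/derivable1_diffP de' _] := de.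
apply: (etrans (congr1 (fun u : CC R -> CC R => u h) (diff_comp dm' de'))).
apply: (etrans (is_derive_diff _ de)).
apply: (etrans (congr1 (fun t => cexp (toC R lam * clog z) * t) (is_derive_diff h dm))).
by rewrite /cpow; ring.
Qed.

Lemma cpow_pred lam z : 0 < complex.Re z -> cpow lam z = z * cpow (lam - 1) z.
Proof.
move=> z0; rewrite /cpow -{2}(clogK z0) -cexpD; congr (cexp _).
by rewrite rmorphB rmorph1; ring.
Qed.

Lemma diff_cpow_pred lam z h : 0 < complex.Re z ->
  'd (cpow lam) z h = toC R lam * cpow (lam - 1) z * h.
Proof.
move=> z0; have zn : z != 0 by apply: contraTneq z0 => ->; rewrite ltxx.
by rewrite diff_cpow// (cpow_pred lam z0); field.
Qed.

End ComplexPower.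

(** * Restriction to complex lines and mixed second differences *)

Lemma line_continuous (K : numFieldType) (W : normedModType K) (x h : W) (s : K) :
  {for s, continuous (fun s : K => x + s *: h)}.
Proof. exact/differentiable_continuous/affine_differentiable. Qed.

Lemma near_line (K : numFieldType) (W : normedModType K) (x h : W) (P : set W) :
  (\forall y \near x, P y) -> \forall s \near (0 : K), P (x + s *: h).
Proof.
move=> nP; have := @line_continuous _ _ x h 0 P.
by rewrite scale0r addr0; apply.
Qed.

Section Lines.
Variables (R : realType) (W : normedModType (CC R)).
Implicit Types (f g : W -> CC R) (a b c x y h p : W).

Lemma diff_line f x h (s : CC R) : differentiable f (x + s *: h) ->
  differentiable (fun s : CC R => f (x + s *: h)) s /\
  'd (fun s : CC R => f (x + s *: h)) s 1 = 'd f (x + s *: h) h.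
Proof.
move=> df; have dl := affine_differentiable x h s.
split; first exact: differentiable_comp.
apply: (etrans (congr1 (fun u : CC R -> CC R => u 1) (diff_comp dl df))) => /=.
congr ('d f _ _).
have dc : differentiable (cst x : CC R -> W) s by exact: differentiable_cst.
have ds : differentiable ( *:%R ^~ h : CC R -> W) s by apply: ex_diff.
have e1 : 'd (cst x : CC R -> W) s 1 = 0.
  exact: (congr1 (fun u : CC R -> W => u 1) (diff_cst _ _)).
have e2 : 'd ( *:%R ^~ h : CC R -> W) s 1 = h.
  have D : is_diff s ( *:%R ^~ h : CC R -> W) ( *:%R ^~ h) by exact: is_diff_scalel.
  exact: (etrans (congr1 (fun u : CC R -> W => u 1) (@diff_val _ _ _ _ _ _ _ D)) (scale1r h)).
apply: (etrans (congr1 (fun u : CC R -> W => u 1) (diffD dc ds))).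
by apply: (etrans (f_equal2 +%R e1 e2)); rewrite add0r.
Qed.

(** The second difference is the increment over the unit interval of the difference of [f] on two
    parallel segments. Its derivative is [t] times a difference of values of ['D_b f], which
    differentiability of ['D_b f] at [p] controls. *)
Lemma second_difference f p a b (e : CC R) :
    (\forall x \near p, differentiable f x) -> 0 < e ->
  \forall t \near (0 : CC R),
    `|f (p + t *: a + t *: b) - f (p + t *: a) - f (p + t *: b) + f p
      - t ^+ 2 * 'D_a ('D_b f) p| <= e * `|t| ^+ 2.
Proof.
move=> nf e0; set T := 'D_b f.
have dT : differentiable T p by exact: derive_differentiable.
(* The remainders occur at displacements of norm at most [|t| (|a| + |b|)] and [|t| |b|]; the [1]
   keeps [N] positive. *)
pose N := `|a| + `|b| + `|b| + 1.
have N0 : 0 < N by rewrite ltr_wpDl// !addr_ge0.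
have eN : 0 < e / N by rewrite divr_gt0.
have : \forall x \near p, differentiable f x /\
   `|T x - T p - 'd T p (x - p)| <= e / N * `|x - p|.
  by apply: filterS2 nf (differentiable_remainder dT eN) => x.
move=> /nbhs_normP[d /= d0 dP].
apply/nbhs_normP; exists (d / N) => /=; first by rewrite divr_gt0.
move=> t /=; rewrite sub0r normrN ltr_pdivlMr// => td.
have near (s : R) : 0 <= s <= 1 ->
   `|t *: a + toC R s *: (t *: b)| <= `|t| * (`|a| + `|b|)
   /\ `|toC R s *: (t *: b)| <= `|t| * `|b|.
  move=> s01; have H : `|toC R s *: (t *: b)| <= `|t| * `|b|.
    by rewrite -[leRHS]normrZ; exact: segment_norm_le.
  split=> //; rewrite mulrDr (le_trans (ler_normD _ _))// lerD//.
  by rewrite normrZ.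
have ab0 : 0 <= `|a| + `|b| by rewrite addr_ge0.
have lt1 : `|t| * (`|a| + `|b|) < d.
  apply: le_lt_trans td; rewrite ler_wpM2l// /N -!addrA lerD2l lerDl addr_ge0//.
have lt2 : `|t| * `|b| < d.
  apply: le_lt_trans td; rewrite ler_wpM2l// /N [`|a| + `|b|]addrC -!addrA lerDl !addr_ge0//.
pose g (s : CC R) := f (p + t *: a + s *: (t *: b)) - f (p + s *: (t *: b))
   - s * (t ^+ 2 * 'D_a T p).
have -> : f (p + t *: a + t *: b) - f (p + t *: a) - f (p + t *: b) + f p
      - t ^+ 2 * 'D_a T p = g (0 + 1) - g 0.
  by rewrite /g !add0r !scale1r !scale0r !addr0 mul1r mul0r subr0; ring.
pose dg r := t * T (p + t *: a + r *: (t *: b)) - t * T (p + r *: (t *: b)) - t ^+ 2 * 'D_a T p.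
have nearP (s : R) : 0 <= s <= 1 -> let r := toC R s in
    [/\ differentiable f (p + t *: a + r *: (t *: b)), differentiable f (p + r *: (t *: b))
     & `|dg r| <= e * `|t| ^+ 2].
  move=> s01 r; have [n1 n2] := near _ s01; rewrite -/r in n1 n2.
  have [d1 e1] : differentiable f (p + t *: a + r *: (t *: b)) /\
      `|T (p + t *: a + r *: (t *: b)) - T p - 'd T p (t *: a + r *: (t *: b))|
         <= e / N * (`|t| * (`|a| + `|b|)).
    have [] := dP (p + t *: a + r *: (t *: b)).
      by rewrite /ball_ /= -addrA opprD addrA subrr add0r normrN (le_lt_trans n1).
    move=> ? H; split=> //; move: H.
    have -> : p + t *: a + r *: (t *: b) - p = t *: a + r *: (t *: b).
      by rewrite addrAC [p + _]addrC addrK.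
    by move=> /le_trans; apply; rewrite ler_wpM2l// ltW.
  have [d2 e2] : differentiable f (p + r *: (t *: b)) /\
      `|T (p + r *: (t *: b)) - T p - 'd T p (r *: (t *: b))|
         <= e / N * (`|t| * `|b|).
    have [] := dP (p + r *: (t *: b)).
      by rewrite /ball_ /= opprD addrA subrr add0r normrN (le_lt_trans n2).
    move=> ? H; split=> //; move: H.
    have -> : p + r *: (t *: b) - p = r *: (t *: b) by rewrite addrC addKr.
    by move=> /le_trans; apply; rewrite ler_wpM2l// ltW.
  split=> //.
  have DE : 'D_a T p = 'd T p a by rewrite deriveE.
  have -> : dg r = t * ((T (p + t *: a + r *: (t *: b)) - T p - 'd T p (t *: a + r *: (t *: b)))
      - (T (p + r *: (t *: b)) - T p - 'd T p (r *: (t *: b)))).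
    have Z1 : 'd T p (t *: a) = t * 'd T p a by rewrite linearZ.
    have D1 x y : 'd T p (x + y) = 'd T p x + 'd T p y by rewrite linearD.
    rewrite D1 Z1 /dg DE; set u1 := 'd T p a; set u2 := 'd T p _.
    set u3 := T _; set u4 := T _; set u5 := T _.
    ring.
  rewrite normrM expr2 mulrCA ler_wpM2l//.
  rewrite (le_trans (ler_normB _ _))// (le_trans (lerD e1 e2))//.
  rewrite -mulrDr -mulrDr.
  have -> : e / N * (`|t| * (`|a| + `|b| + `|b|)) = e * `|t| * ((`|a| + `|b| + `|b|) / N).
    by ring.
  rewrite ler_piMr ?mulr_ge0 ?(ltW e0)//.
  by rewrite ler_pdivrMr// mul1r /N lerDl.
have dgP (s : R) : 0 <= s <= 1 ->
    differentiable g (toC R s) /\ 'd g (toC R s) 1 = dg (toC R s).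
  move=> /nearP; set r := toC R s => -[d1 d2 _].
  have [l1 l1'] := diff_line d1; have [l2 l2'] := diff_line d2.
  have dc : differentiable (fun w : CC R => w * (t ^+ 2 * 'D_a T p)) r.
    by apply: differentiableM => //; exact: differentiable_cst.
  have dcE : 'd (fun w : CC R => w * (t ^+ 2 * 'D_a T p)) r 1 = t ^+ 2 * 'D_a T p.
    have H : is_derive r 1 (fun w : CC R => w * (t ^+ 2 * 'D_a T p)) (t ^+ 2 * 'D_a T p).
      apply: remainder_is_derive => e' e0'; apply: filterE => w.
      rewrite (_ : _ - _ = 0) ?normr0 ?mulr_ge0 ?(ltW e0')//; ring.
    by rewrite (is_derive_diff _ H) mulr1.
  have l3 : differentiable (fun w : CC R => f (p + t *: a + w *: (t *: b)) - f (p + w *: (t *: b))) r.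
    exact: differentiableB.
  split; first exact: (differentiableB l3 dc).
  apply: (etrans (@diff_sub R (CC R) _ _ _ 1 l3 dc)); apply: f_equal2; last by rewrite dcE.
  apply: (etrans (@diff_sub R (CC R) _ _ _ 1 l1 l2)).
  have Zf y : differentiable f y -> 'd f y (t *: b) = t * T y.
    by move=> dy; rewrite /T deriveE// linearZ.
  exact: (f_equal2 (fun u v : CC R => u - v) (etrans l1' (Zf _ d1)) (etrans l2' (Zf _ d2))).
apply: (@mean_value_inequality R (CC R) g 0 1 _) => s s01; rewrite add0r [_ *: 1]mulr1.
  by have [] := dgP _ s01.
by have [_ ->] := dgP _ s01; have [] := nearP _ s01.
Qed.

End Lines.

(** * Uniqueness of polarizations *)

Section Diagonal.
Variables (R : realType) (m : nat).
Local Notation C := (CC R).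
Local Notation V := 'rV[C]_m.
Implicit Types (f g : V * V -> C) (w z h : V) (v a b : V * V).

Lemma conj_vecK : involutive (@conj_vec R m).
Proof. by move=> w; apply/rowP => i; rewrite !mxE conjCK. Qed.

Lemma conj_vecD w z : conj_vec (w + z) = conj_vec w + conj_vec z.
Proof. by apply/rowP => i; rewrite !mxE rmorphD. Qed.

Lemma conj_vecZ (s : C) w : conj_vec (s *: w) = s^* *: conj_vec w.
Proof. by apply/rowP => i; rewrite !mxE rmorphM. Qed.

Lemma continuous_conj_vec : continuous (@conj_vec R m).
Proof.
move=> w; change (@conj_vec R m @ nbhs w --> conj_vec w).
apply/cvg_ballP => e e0; near=> z.
have wz : ball w e z by near: z; exact: nbhsx_ballx.
split=> // i j; have [_ /(_ i j)] := wz.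
by rewrite -!ball_normE /= !mxE -rmorphB norm_conjC.
Unshelve. all: by end_near. Qed.

Lemma continuous_swap_conj (q : V * V) :
  {for q, continuous (fun q : V * V => (q.1, conj_vec q.2))}.
Proof.
case: q => x y.
have c1 : (fun q : V * V => q.1) @ nbhs (x, y) --> nbhs x by exact: cvg_fst.
have c2 : (fun q : V * V => conj_vec q.2) @ nbhs (x, y) --> nbhs (conj_vec y).
  apply: (@cvg_comp _ _ _ (fun q : V * V => q.2) (@conj_vec R m) _ (nbhs y)).
    exact: cvg_snd.
  exact: continuous_conj_vec.
exact: (cvg_pair c1 c2).
Qed.

Lemma continuous_diag w : {for w, continuous (fun z : V => (z, conj_vec z))}.
Proof.
have c1 : (fun z : V => z) @ nbhs w --> nbhs w by exact: cvg_id.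
exact: (cvg_pair c1 (@continuous_conj_vec w)).
Qed.

(* The vectors [(h, conj h)] span [V * V] over the complex numbers, so the
   differential vanishes as soon as it does on them. *)
Lemma diff_diag0 f w :
    differentiable f (w, conj_vec w) ->
    (\forall z \near w, f (z, conj_vec z) = 0) ->
  forall v, 'd f (w, conj_vec w) v = 0.
Proof.
move=> df f0; set p := (w, conj_vec w).
have real_dir h : 'd f p (h, conj_vec h) = 0.
  set v := (h, conj_vec h); apply/eqP; rewrite -normr_le0; apply/ler_addgt0Pr => e e0.
  rewrite add0r.
  have v1 : 0 < `|v| + 1 by rewrite ltr_wpDl.
  have H1 := near_line v (differentiable_remainder df (divr_gt0 e0 v1)).
  have H2 := near_line h f0.
  have : \forall s \near (0 : C),
      `|f (p + s *: v) - f p - 'd f p (p + s *: v - p)|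
         <= e / (`|v| + 1) * `|p + s *: v - p|
      /\ f (w + s *: h, conj_vec (w + s *: h)) = 0.
    by apply: filterS2 H1 H2 => s.
  move=> /nbhs_normP[d /= d0 dP].
  (* A real step is essential: only then does conjugation commute with scaling, so that the
     displaced point stays on the conjugate diagonal. *)
  pose s := d / 2; have s0 : 0 < s by rewrite divr_gt0.
  have sd : ball_ Num.Def.normr 0 d s.
    by rewrite /ball_ /= sub0r normrN gtr0_norm// /s ltr_pdivrMr// ltr_pMr// ltr1n.
  have [] := dP s sd; rewrite /=.
  have sr : s^* = s by apply/CrealP; exact: gtr0_real.
  have -> : p + s *: v = (w + s *: h, conj_vec (w + s *: h)).
    by rewrite conj_vecD conj_vecZ sr.
  move=> + E; rewrite E.
  have -> : f p = 0 by exact: nbhs_singleton f0.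
  have -> : (w + s *: h, conj_vec (w + s *: h)) - p = s *: v.
    rewrite conj_vecD conj_vecZ sr -[LHS]/(w + s *: h - w, _ - conj_vec w).
    by rewrite addrC addKr [X in (_, X)]addrC addKr.
  have -> : 'd f p (s *: v) = s * 'd f p v by rewrite linearZ.
  rewrite subr0 sub0r normrN normrM normrZ mulrCA ler_pM2l ?normr_gt0 ?gt_eqF//.
  move=> /le_trans; apply.
  by rewrite mulrAC ler_pdivrMr// ler_wpM2l ?(ltW e0)// lerDl.
have half (x y : C) : x + y = 0 -> x - y = 0 -> x = 0 /\ y = 0.
  move=> h1 h2; have h3 : x * 2 = 0 by rewrite -[RHS](addr0 0) -{1}h1 -h2; ring.
  have x0 : x = 0 by apply/eqP; move/eqP: h3; rewrite mulf_eq0 pnatr_eq0 orbF.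
  by split=> //; rewrite -h1 x0 add0r.
(* Replacing [h] by ['i *: h] changes the relative sign of the two components, so their sum and
   their difference both vanish. *)
have split h : 'd f p (h, 0) = 0 /\ 'd f p (0, conj_vec h) = 0.
  apply: half.
    rewrite -linearD -[(h, 0) + _]/(h + 0, 0 + conj_vec h) addr0 add0r.
    exact: real_dir.
  have := real_dir ('i *: h); rewrite conj_vecZ conjCi.
  have -> : ('i *: h, - 'i *: conj_vec h) = 'i *: ((h, 0) - (0, conj_vec h)).
    rewrite -[RHS]/('i *: (h - 0), 'i *: (0 - conj_vec h)).
    by rewrite subr0 sub0r scaleNr scalerN.
  rewrite linearZ linearB => /eqP; rewrite mulf_eq0 (negPf (neq0Ci _)) /= => /eqP.
  exact.
move=> [a b].
have -> : (a, b) = (a, 0) + (0, conj_vec (conj_vec b)).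
  by rewrite conj_vecK -[RHS]/(a + 0, 0 + b) addr0 add0r.
have [e1 _] := split a; have [_ e2] := split (conj_vec b).
apply: (etrans (linearD ('d f p) (a, 0) (0, conj_vec (conj_vec b)))).
by apply: (etrans (f_equal2 +%R e1 e2)); rewrite addr0.
Qed.

Lemma diff_diag_eq f g w :
    differentiable f (w, conj_vec w) -> differentiable g (w, conj_vec w) ->
    (\forall z \near w, f (z, conj_vec z) = g (z, conj_vec z)) ->
  forall v, 'D_v f (w, conj_vec w) = 'D_v g (w, conj_vec w).
Proof.
move=> df dg fg v.
apply: (etrans (deriveE v df)); apply: esym; apply: (etrans (deriveE v dg)); apply: esym.
apply/eqP; rewrite -subr_eq0; apply/eqP; apply: (etrans (esym (diff_sub v df dg))).
apply: diff_diag0; first exact: differentiableB.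
by apply: filterS fg => z ->; rewrite subrr.
Qed.

Lemma diff2_diag_eq f g w :
    (\forall q \near (w, conj_vec w), differentiable f q) ->
    (\forall q \near (w, conj_vec w), differentiable g q) ->
    (\forall z \near w, f (z, conj_vec z) = g (z, conj_vec z)) ->
  forall a b, 'D_a ('D_b f) (w, conj_vec w) = 'D_a ('D_b g) (w, conj_vec w).
Proof.
move=> nf ng fg a b.
have n1 : \forall z \near w, differentiable f (z, conj_vec z).
  exact: (continuous_diag nf).
have n2 : \forall z \near w, differentiable g (z, conj_vec z).
  exact: (continuous_diag ng).
have n3 : \forall z \near w, 'D_b f (z, conj_vec z) = 'D_b g (z, conj_vec z).
  by apply: filterS3 (near_join fg) n1 n2 => z fg' d1 d2; apply: diff_diag_eq.
exact: (diff_diag_eq (derive_differentiable b nf) (derive_differentiable b ng) n3).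
Qed.

End Diagonal.

(** * Second derivatives of powers *)

Section Calculus.
Variables (R : realType) (W : normedModType (CC R)).
Implicit Types (f g k : W -> CC R) (a b p x h v : W).

Lemma diff_mul f g x h : differentiable f x -> differentiable g x ->
  'd (fun y => f y * g y) x h = f x * 'd g x h + g x * 'd f x h.
Proof.
move=> df dg.
exact: (congr1 (fun u : W -> CC R => u h) (diffM df dg)).
Qed.

Lemma diff_add f g x h : differentiable f x -> differentiable g x ->
  'd (fun y => f y + g y) x h = 'd f x h + 'd g x h.
Proof.
move=> df dg; exact: (congr1 (fun u : W -> CC R => u h) (diffD df dg)).
Qed.

Lemma diff_cmul (c : CC R) f x h : differentiable f x ->
  'd (fun y => c * f y) x h = c * 'd f x h.
Proof.
move=> df; have dc : differentiable (cst c : W -> CC R) x by exact: differentiable_cst.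
apply: (etrans (diff_mul h dc df)).
have e : 'd (cst c : W -> CC R) x h = 0.
  exact: (congr1 (fun u : W -> CC R => u h) (diff_cst _ _)).
apply: (etrans (congr1 (fun t => c * 'd f x h + f x * t) e)).
by rewrite mulr0 addr0.
Qed.

Lemma differentiable_cmul (c : CC R) f x : differentiable f x ->
  differentiable (fun y => c * f y) x.
Proof. by move=> df; apply: differentiableM => //; exact: differentiable_cst. Qed.

Lemma diff_lincomb (I : Type) (s : seq I) (c : I -> CC R) (F : I -> W -> CC R) x h :
    (forall i, differentiable (F i) x) ->
  differentiable (fun y => \sum_(i <- s) c i * F i y) x /\
  'd (fun y => \sum_(i <- s) c i * F i y) x h = \sum_(i <- s) c i * 'd (F i) x h.
Proof.
move=> dF; elim: s => [|i s [IH1 IH2]].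
  have -> : (fun y => \sum_(i <- [::]) c i * F i y) = cst 0.
    by apply/funext => y; rewrite big_nil.
  rewrite big_nil; split; first exact: differentiable_cst.
  exact: (congr1 (fun u : W -> CC R => u h) (diff_cst _ _)).
have -> : (fun y => \sum_(j <- i :: s) c j * F j y) =
    (fun y => c i * F i y + \sum_(j <- s) c j * F j y).
  by apply/funext => y; rewrite big_cons.
have d1 := differentiable_cmul (c i) (dF i).
split; first exact: differentiableD.
rewrite big_cons; apply: (etrans (diff_add h d1 IH1)).
exact: (f_equal2 +%R (diff_cmul (c i) h (dF i)) IH2).
Qed.

Lemma near_eq_D f g p v : (\forall x \near p, f x = g x) -> differentiable f p ->
  'D_v g p = 'D_v f p.
Proof.
move=> fg df; have [dg dfg] := near_eq_differentiable (nbhs_singleton fg) fg df.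
apply: (etrans (deriveE v dg)); apply: etrans (esym (deriveE v df)).
exact: (congr1 (fun u : W -> CC R => u v) dfg).
Qed.

Lemma line_remainder f q v (e : CC R) : differentiable f q -> 0 < e ->
  \forall t \near (0 : CC R), `|f (q + t *: v) - f q - t * 'D_v f q| <= e * `|t|.
Proof.
move=> df e0.
have v1 : 0 < `|v| + 1 by rewrite ltr_wpDl.
have := near_line v (differentiable_remainder df (divr_gt0 e0 v1)).
apply: filterS => t; rewrite [q + _ - q]addrC addKr.
have -> : 'd f q (t *: v) = t * 'D_v f q by rewrite (deriveE v df) linearZ.
move=> /le_trans; apply; rewrite normrZ mulrCA [leRHS]mulrC ler_wpM2l//.
by rewrite mulrAC ler_pdivrMr// ler_wpM2l ?(ltW e0)// lerDl.
Qed.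

Lemma D_lincomb f p (I : Type) (s : seq I) (c : I -> CC R) (u : I -> W) :
    differentiable f p ->
  'D_(\sum_(i <- s) c i *: u i) f p = \sum_(i <- s) c i * 'D_(u i) f p.
Proof.
move=> df; apply: (etrans (deriveE _ df)).
rewrite linear_sum; apply: eq_bigr => i _.
by rewrite (deriveE _ df) linearZ.
Qed.

Lemma D2_lincomb f p (I J : Type) (r : seq I) (s : seq J) (c : I -> CC R) (u : I -> W)
    (d : J -> CC R) (v : J -> W) :
    (\forall q \near p, differentiable f q) ->
  'D_(\sum_(i <- r) c i *: u i) ('D_(\sum_(j <- s) d j *: v j) f) p
    = \sum_(i <- r) \sum_(j <- s) c i * d j * 'D_(u i) ('D_(v j) f) p.
Proof.
move=> nf.
have dT b : differentiable ('D_b f) p by exact: derive_differentiable.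
apply: (etrans (D_lincomb r c u (dT _))); apply: eq_bigr => i _.
have [dS DS] := diff_lincomb s d (u i) (fun j => dT (v j)).
have E : \forall q \near p, \sum_(j <- s) d j * 'D_(v j) f q = 'D_(\sum_(j <- s) d j *: v j) f q.
  by apply: filterS nf => q dq; rewrite D_lincomb.
have e : 'D_(u i) ('D_(\sum_(j <- s) d j *: v j) f) p = \sum_(j <- s) d j * 'd ('D_(v j) f) p (u i).
  apply: (etrans (near_eq_D (u i) E dS)); exact: (etrans (deriveE _ dS) DS).
apply: (etrans (congr1 (fun t => c i * t) e)).
rewrite mulr_sumr; apply: eq_bigr => j _.
rewrite -[RHS]mulrA; congr (_ * (_ * _)).
exact: (esym (deriveE (u i) (dT (v j)))).
Qed.

Lemma cpow_comp_differentiable (lam : R) k q :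
    differentiable k q -> 0 < complex.Re (k q) ->
  differentiable (fun y => cpow lam (k y)) q.
Proof.
by move=> dk k0; apply: differentiable_comp => //; exact: differentiable_cpow.
Qed.

Lemma cpow_comp_D (lam : R) k q v : differentiable k q -> 0 < complex.Re (k q) ->
  'D_v (fun y => cpow lam (k y)) q = toC R lam * (cpow (lam - 1) (k q) * 'D_v k q).
Proof.
move=> dk k0; have dc := cpow_comp_differentiable lam dk k0.
apply: (etrans (deriveE v dc)).
apply: (etrans (congr1 (fun u : W -> CC R => u v) (diff_comp dk (differentiable_cpow lam k0)))).
apply: (etrans (diff_cpow_pred lam ('d k q v) k0)).
by rewrite (deriveE v dk) mulrA.
Qed.

Lemma cpow_comp_D2 (lam : R) k p a b :
    (\forall q \near p, differentiable k q) -> 0 < complex.Re (k p) ->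
  'D_a ('D_b (fun y => cpow lam (k y))) p
    = toC R lam * (cpow (lam - 1) (k p) * 'D_a ('D_b k) p
       + 'D_b k p * (toC R (lam - 1) * (cpow (lam - 1 - 1) (k p) * 'D_a k p))).
Proof.
move=> nk k0.
have dk := nbhs_singleton nk; have dT := derive_differentiable b nk.
have du := cpow_comp_differentiable (lam - 1) dk k0.
have nre : \forall q \near p, 0 < complex.Re (k q).
  have := near_Re_gt0 k0; exact: (differentiable_continuous dk).
have E : \forall q \near p, toC R lam * (cpow (lam - 1) (k q) * 'D_b k q)
     = 'D_b (fun y => cpow lam (k y)) q.
  by apply: filterS2 nk nre => q dq q0; rewrite cpow_comp_D.
have duv : differentiable (fun q => cpow (lam - 1) (k q) * 'D_b k q) p.
  exact: differentiableM.
have d := differentiable_cmul (toC R lam) duv.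
apply: (etrans (near_eq_D a E d)); apply: (etrans (deriveE a d)).
apply: (etrans (diff_cmul (toC R lam) a duv)); congr (_ * _).
apply: (etrans (diff_mul a du dT)).
apply: (etrans (f_equal2 (fun s t => cpow (lam - 1) (k p) * s + 'D_b k p * t)
  (esym (deriveE a dT)) (esym (deriveE a du)))).
by rewrite cpow_comp_D.
Qed.

End Calculus.

(** * Derivatives of a kernel and the quadratic form of the matrix *)

(** Both derivatives are limits of the same quotients, so partial derivatives in one variable become
    directional derivatives on the product without any differentiability assumption. *)
Lemma derive_along (K : numFieldType) (U V W : normedModType K) (f : U -> W) (g : V -> W)
    (a u : U) (b v : V) :
  (forall h : K, f (h *: u + a) = g (h *: v + b)) -> 'D_u f a = 'D_v g b.
Proof.
move=> fg; have fgab : f a = g b by have := fg 0; rewrite !scale0r !add0r.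
rewrite /derive; have -> // : (fun h => h^-1 *: ((f \o shift a) (h *: u) - f a))
  = (fun h => h^-1 *: ((g \o shift b) (h *: v) - g b)).
by apply/funext => h /=; rewrite fgab fg.
Qed.

Section Forms.
Variables (R : realType) (m : nat).
Local Notation C := (CC R).
Local Notation V := 'rV[C]_m.

(** This is the function whose complex differentiability [sesquiholomorphic] expresses; the diagonal
    becomes the set of points [(w, conj_vec w)]. *)
Definition polar (F : V -> V -> C) : V * V -> C := fun q => F q.1 (conj_vec q.2).

Lemma partial_bar0 (F : V -> V -> C) : partial_bar ord0 F = F.
Proof. by apply/funext => z; apply/funext => w; rewrite /partial_bar unlift_none. Qed.

Lemma partial_barS (F : V -> V -> C) k z w :
  partial_bar (lift ord0 k) F z w = 'D_((0, delta_mx 0 k) : V * V) (polar F) (z, conj_vec w).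
Proof.
rewrite /partial_bar liftK; apply: derive_along => h.
by rewrite /polar /= scaler0 add0r.
Qed.

Lemma partial0 (F : V -> V -> C) z w : partial ord0 F z w = F z w.
Proof. by rewrite /partial unlift_none. Qed.

(** The function [g] is left free because the lemma is also applied to [partial_bar] of a kernel,
    with [g] a derivative of its [polar]. *)
Lemma partialS (F : V -> V -> C) (g : V * V -> C) k z w :
    (forall u, F u w = g (u, conj_vec w)) ->
  partial (lift ord0 k) F z w = 'D_((delta_mx 0 k, 0) : V * V) g (z, conj_vec w).
Proof.
move=> Fg; rewrite /partial liftK; apply: derive_along => h; rewrite Fg.
by rewrite -[h *: (delta_mx 0 k, 0) + _]/(h *: delta_mx 0 k + z, h *: 0 + conj_vec w) scaler0 add0r.
Qed.

Lemma pair_sum1 (v : V) : (v, 0) = \sum_k v 0 k *: ((delta_mx 0 k, 0) : V * V).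
Proof.
apply: injective_projections.
  by rewrite [LHS]row_sum_delta (big_morph fst (id1 := 0) (op1 := +%R)).
rewrite (big_morph snd (id1 := 0) (op1 := +%R))// big1// => k _.
by rewrite /= scaler0.
Qed.

Lemma pair_sum2 (v : V) : (0, v) = \sum_k v 0 k *: ((0, delta_mx 0 k) : V * V).
Proof.
apply: injective_projections.
  rewrite (big_morph fst (id1 := 0) (op1 := +%R))// big1// => k _.
  by rewrite /= scaler0.
by rewrite [LHS]row_sum_delta (big_morph snd (id1 := 0) (op1 := +%R)).
Qed.

Lemma sesqui_form_recl (M : 'M[C]_m.+1) (v : 'rV[C]_m.+1) :
  let x := v 0 ord0 in
  (v *m M *m (v ^t*)%sesqui) 0 0 =
    x * x^* * M ord0 ord0
    + x * (\sum_l (v 0 (lift ord0 l))^* * M ord0 (lift ord0 l))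
    + x^* * (\sum_k v 0 (lift ord0 k) * M (lift ord0 k) ord0)
    + \sum_l \sum_k (v 0 (lift ord0 l))^* * v 0 (lift ord0 k) * M (lift ord0 k) (lift ord0 l).
Proof.
move=> x; rewrite mxE big_ord_recl !mxE big_ord_recl -/x.
have -> : \sum_(i < m) (v *m M) 0 (lift ord0 i) * (v ^t*)%sesqui (lift ord0 i) 0
  = x * (\sum_l (v 0 (lift ord0 l))^* * M ord0 (lift ord0 l))
   + \sum_l \sum_k (v 0 (lift ord0 l))^* * v 0 (lift ord0 k) * M (lift ord0 k) (lift ord0 l).
  rewrite mulr_sumr -big_split /=; apply: eq_bigr => l _.
  rewrite !mxE big_ord_recl mulrDl -/x; congr (_ + _); first by ring.
  by rewrite mulr_suml; apply: eq_bigr => k _; ring.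
by ring.
Qed.

Definition tailv (v : 'rV[C]_m.+1) : V := \row_k v 0 (lift ord0 k).

(* The quadratic form of the matrix in the theorem, with [x] the coordinate of
   index [0] and [v] the others. *)
Definition jet_form (F : V -> V -> C) (w : V) (x : C) (v : V) : C :=
  let f := polar F in let p := (w, conj_vec w) in
  let A : V * V := (conj_vec v, 0) in let B : V * V := (0, v) in
  x * x^* * f p + x * 'D_A f p + x^* * 'D_B f p + 'D_A ('D_B f) p.

(** Rows carry the derivatives in the second variable with weights [v], columns those in the first
    with conjugate weights. Linearity collects them into the directions [(0, v)] and
    [(conj_vec v, 0)]. *)
Lemma form_expand (F : V -> V -> C) (w : V) (v : 'rV[C]_m.+1) :
    (\forall q \near (w, conj_vec w), differentiable (polar F) q) ->
  (v *m (\matrix_(i, j) partial j (partial_bar i F) w w) *m (v ^t*)%sesqui) 0 0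
  = jet_form F w (v 0 ord0) (tailv v).
Proof.
move=> nf; rewrite /jet_form; set f := polar F; set p := (w, _); set x := v 0 ord0.
set A : V * V := (conj_vec _, 0); set B : V * V := (0, tailv v).
have df := nbhs_singleton nf.
have fp u : F u w = f (u, conj_vec w) by rewrite /f /polar /= conj_vecK.
have eA : A = \sum_l (v 0 (lift ord0 l))^* *: ((delta_mx 0 l, 0) : V * V).
  by rewrite /A pair_sum1; apply: eq_bigr => l _; rewrite !mxE.
have eB : B = \sum_k v 0 (lift ord0 k) *: ((0, delta_mx 0 k) : V * V).
  by rewrite /B pair_sum2; apply: eq_bigr => l _; rewrite !mxE.
have DA : 'D_A f p = \sum_l (v 0 (lift ord0 l))^* * 'D_((delta_mx 0 l, 0) : V * V) f p.
  by apply: (etrans (congr1 (fun u => 'D_u f p) eA)); exact: D_lincomb.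
have DB : 'D_B f p = \sum_k v 0 (lift ord0 k) * 'D_((0, delta_mx 0 k) : V * V) f p.
  by apply: (etrans (congr1 (fun u => 'D_u f p) eB)); exact: D_lincomb.
have DAB : 'D_A ('D_B f) p = \sum_l \sum_k (v 0 (lift ord0 l))^* * v 0 (lift ord0 k)
    * 'D_((delta_mx 0 l, 0) : V * V) ('D_((0, delta_mx 0 k) : V * V) f) p.
  apply: (etrans (f_equal2 (fun s t => 'D_s ('D_t f) p) eA eB)); exact: D2_lincomb.
rewrite sesqui_form_recl -/x DA DB DAB.
congr (_ + _ + _ + _).
- by rewrite mxE partial_bar0 partial0 fp.
- congr (_ * _); apply: eq_bigr => l _; rewrite mxE partial_bar0; congr (_ * _).
  exact: partialS.
- congr (_ * _); apply: eq_bigr => k _; rewrite mxE partial0; congr (_ * _).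
  exact: partial_barS.
- apply: eq_bigr => l _; apply: eq_bigr => k _; rewrite mxE; congr (_ * _).
  by apply: partialS => u; exact: partial_barS.
Qed.

End Forms.

(** * Positivity *)

(** Nonnegativity includes reality, so the approximations must also force the imaginary part to
    vanish. *)
Lemma ge0_approx (R : realType) (x : CC R) :
  (forall e : CC R, 0 < e -> exists2 s, 0 <= s & `|x - s| <= e) -> 0 <= x.
Proof.
move=> H.
have reH (e : R) : 0 < e -> `|complex.Im x| <= e /\ - e <= complex.Re x.
  move=> e0; have [|s s0 xs] := H (toC R e).
    by rewrite -(rmorph0 (toC R)) toC_lt.
  have [r r0 sr] := ge0_toC s0.
  have := le_trans (Re_le (x - s)) xs; have := le_trans (Im_le (x - s)) xs.
  rewrite !toC_le ReB ImB sr /= subr0 => ? /ler_normlP[h1 _]; split=> //.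
  by move: h1 r0; move: (complex.Re x) => t; clear; lra.
have I0 : complex.Im x = 0.
  apply/eqP; rewrite -normr_le0; apply/ler_addgt0Pr => e e0; rewrite add0r.
  by have [] := reH e e0.
have R0 : 0 <= complex.Re x.
  apply/ler_addgt0Pr => e e0; have [_] := reH e e0.
  by rewrite -lerBlDr sub0r.
by case: x I0 R0 {H reH} => a b /= -> a0; rewrite lecE /= eqxx.
Qed.

(* Equality case of the Cauchy-Schwarz inequality. *)
Lemma sesquilinear_zero (R : realType) (D E G : CC R) :
  (forall y, 0 <= y * y^* * D + y * E + y^* * G) -> E = 0.
Proof.
move=> H.
(* At [y = s * c] with small [s > 0], dividing by [s] leaves the quadratic term with a factor [s],
   and only the linear part survives. Using [c] and [- c] then makes it vanish. *)
have half (T S : CC R) (c : CC R) : c * c^* = 1 ->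
    c * E + c^* * G = T -> 0 <= T.
  move=> c1 <-; apply: ge0_approx => e e0.
  have D1 : 0 < `|D| + 1 by rewrite ltr_wpDl.
  pose s := e / (`|D| + 1); have s0 : 0 < s by rewrite divr_gt0.
  have sr : s^* = s by apply/CrealP; exact: gtr0_real.
  exists (s * D + (c * E + c^* * G)).
    rewrite -(pmulr_rge0 _ s0).
    have := H (s * c); rewrite rmorphM /= sr.
    have -> : s * c * (s * c^*) * D = s * s * (c * c^*) * D by ring.
    by rewrite c1 mulr1; congr (_ <= _); ring.
  rewrite opprD addrCA subrr addr0 normrN normrM gtr0_norm// /s.
  by rewrite mulrAC ler_pdivrMr// ler_wpM2l ?(ltW e0)// lerDl.
have zero (c : CC R) : c * c^* = 1 -> c * E + c^* * G = 0.
  move=> c1; apply/eqP; rewrite eq_le; apply/andP; split; last exact: (half _ 0 c).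
  rewrite -oppr_ge0; apply: (half _ 0 (- c)); first by rewrite rmorphN mulrNN.
  by rewrite rmorphN; ring.
have h1 := zero 1 (etrans (mul1r _) (rmorph1 _)).
have h2 : 'i * E + - 'i * G = 0.
  by rewrite -(conjCi (CC R)); apply: zero; rewrite conjCi mulrN -expr2 sqrCi opprK.
move: h1; rewrite rmorph1 !mul1r => h1.
have h3 : 'i * (E - G) = 0 by rewrite -h2; ring.
have h4 : E = G.
  by apply/eqP; rewrite -subr_eq0; move/eqP: h3; rewrite mulf_eq0 (negPf (neq0Ci _)).
have : E * 2 = 0 by rewrite -h1 -h4; ring.
by move/eqP; rewrite mulf_eq0 pnatr_eq0 orbF => /eqP.
Qed.

(** Positivity makes [x * a + x^* * b] real for all [x]; the values at [1] and ['i] determine the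
    relation between [a] and [b]. *)
Lemma hermitian_of_ge0 (C : numClosedFieldType) (k a b g : C) : k^* = k ->
  (forall x, 0 <= x * x^* * k + x * a + x^* * b + g) -> b^* = a.
Proof.
move=> kr H.
have real x : (x * a + x^* * b)^* = x * a + x^* * b.
  have r1 : (x * x^* * k + x * a + x^* * b + g)^* = x * x^* * k + x * a + x^* * b + g.
    by apply/CrealP; exact: ger0_real.
  have r2 : g^* = g.
    by apply/CrealP; apply: ger0_real; have := H 0; rewrite rmorph0 !mul0r !add0r.
  move: r1; rewrite !rmorphD !rmorphM /= conjCK kr r2 => r1.
  have -> : x^* * a^* + x * b^* =
    (x^* * x * k + x^* * a^* + x * b^* + g) - (x * x^* * k + g) by ring.
  by rewrite r1; ring.
have h1 := real 1; have h2 := real 'i.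
move: h1 h2; rewrite !rmorphD !rmorphM /= !conjCK rmorph1 !mul1r conjCi => h1 h2.
have h3 : 'i * (b^* - a^*) = 'i * (a - b).
  have -> : 'i * (b^* - a^*) = - 'i * a^* + 'i * b^* by ring.
  by rewrite h2; ring.
have h4 : b^* - a^* = a - b by apply: (mulfI (neq0Ci _)) h3.
have : b^* * 2 = a * 2.
  have -> : b^* * 2 = (b^* - a^*) + (a^* + b^*) by ring.
  by rewrite h4 h1; ring.
by apply: mulIf; rewrite pnatr_eq0.
Qed.

(* Completing the square: the form is
   [Q |k x + l b|^2 + l k Q (g - a b / k)], and [g - a b / k] is the Schur
   complement of [k] in the form with [l = 1], [Q = 1/k]. *)
Lemma power_form_gt0 (C : numClosedFieldType) (x k a b g l Q : C) :
    0 < k -> 0 < l -> 0 < Q -> a = b^* -> 0 < g - a * b / k ->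
  0 < x * x^* * (k * (k * Q)) + x * (l * (k * Q * a)) + x^* * (l * (k * Q * b))
    + l * (k * Q * g + b * ((l - 1) * (Q * a))).
Proof.
move=> k0 l0 Q0 ab g0.
have kr : k^* = k by apply/CrealP; exact: gtr0_real.
have lr : l^* = l by apply/CrealP; exact: gtr0_real.
have -> : x * x^* * (k * (k * Q)) + x * (l * (k * Q * a)) + x^* * (l * (k * Q * b))
    + l * (k * Q * g + b * ((l - 1) * (Q * a)))
  = Q * ((k * x + l * b) * (k * x + l * b)^*) + Q * (l * k * (g - a * b / k)).
  rewrite rmorphD !rmorphM /= kr lr -ab; field.
  by rewrite gt_eqF.
by rewrite ltr_wpDl ?mulr_gt0// mulr_ge0 ?(ltW Q0)// mul_conjC_ge0.
Qed.

Lemma open_setX (T U : topologicalType) (A : set T) (B : set U) :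
  open A -> open B -> open (A `*` B).
Proof.
move=> oA oB; rewrite openE => -[x y] [/= Ax By].
by exists (A, B); [split; exact: open_nbhs_nbhs|move=> [? ?]].
Qed.

Lemma near_and (T : Type) (F : set_system T) {FF : Filter F} (P Q : T -> Prop) :
  (\forall t \near F, P t) -> (\forall t \near F, Q t) -> \forall t \near F, P t /\ Q t.
Proof. by apply: filterS2. Qed.

Lemma near0_gt0 (K : numFieldType) (P : K -> Prop) :
  (\forall t \near (0 : K), P t) -> exists2 t, 0 < t & P t.
Proof.
move=> /nbhs_normP[d /= d0 dP]; have d20 : 0 < d / 2 by rewrite divr_gt0.
exists (d / 2) => //; apply: dP.
by rewrite /ball_ /= sub0r normrN gtr0_norm// ltr_pdivrMr// ltr_pMr// ltr1n.
Qed.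

(** * Kernel matrices at nearby points and their limits *)

Section Kernel.
Variables (R : realType) (m : nat).
Local Notation C := (CC R).
Local Notation V := 'rV[C]_m.
Variables (Omega : set V) (K : V -> V -> C).
Hypothesis Omega_open : open Omega.

Lemma sesqui_near (W : set (V * V)) F w : open W -> W (w, w) ->
  sesquiholomorphic W F ->
  \forall q \near (w, conj_vec w), differentiable (polar F) q.
Proof.
move=> oW Ww hF.
have nW : nbhs (w, conj_vec (conj_vec w)) W.
  by rewrite conj_vecK; exact: (open_nbhs_nbhs (conj oW Ww)).
have n1 : \forall q \near (w, conj_vec w), W (q.1, conj_vec q.2).
  exact: (@continuous_swap_conj R m (w, conj_vec w) _ nW).
apply: filterS n1 => -[z u] /= Wzu.
by have := hF _ Wzu; rewrite /= conj_vecK.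
Qed.

Hypothesis K_pos : positive_definite_kernel Omega K.
Hypothesis K_hol : sesquiholomorphic (Omega `*` Omega) K.

Lemma polar_near z w : Omega z -> Omega w ->
  differentiable (polar K) (z, conj_vec w).
Proof. by move=> Oz Ow; exact: (@K_hol (z, w)). Qed.

Lemma kernel3_ge0 (z1 z2 z3 : V) (x1 x2 x3 : C) :
    Omega z1 -> Omega z2 -> Omega z3 ->
  0 <= x1 * x1^* * K z1 z1 + x2 * x1^* * K z2 z1 + x3 * x1^* * K z3 z1
     + x1 * x2^* * K z1 z2 + x2 * x2^* * K z2 z2 + x3 * x2^* * K z3 z2
     + x1 * x3^* * K z1 z3 + x2 * x3^* * K z2 z3 + x3 * x3^* * K z3 z3.
Proof.
move=> O1 O2 O3.
pose z := tnth [tuple z1; z2; z3]; pose x := tnth [tuple x1; x2; x3].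
have Oz i : Omega (z i) by case: i => -[|[|[|]]] // i3; rewrite /z (tnth_nth z1).
have := K_pos Oz (\row_i x i).
rewrite !mxE !big_ord_recl big_ord0 !mxE !big_ord_recl !big_ord0 !mxE.
rewrite /x /z !(tnth_nth z1) !(tnth_nth x1) /=.
by congr (0 <= _); ring.
Qed.

(* Positivity of the kernel at the points [z], [w], [w + t conj v], with
   weights chosen to produce difference quotients, as the real number [t > 0]
   tends to [0]. *)
Lemma kernel_jet_ge0 (z w v : V) (x y : C) : Omega z -> Omega w ->
  0 <= y * y^* * K z z
     + y * (x * K z w + 'D_((0, v) : V * V) (polar K) (z, conj_vec w))
     + y^* * (x^* * K w z + 'D_((conj_vec v, 0) : V * V) (polar K) (w, conj_vec z))
     + jet_form K w x v.
Proof.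
move=> Oz Ow; rewrite /jet_form; set k := polar K; set p := (w, conj_vec w).
set A : V * V := (conj_vec v, 0); set B : V * V := (0, v).
have nk : \forall q \near p, differentiable k q.
  by apply: (@sesqui_near (Omega `*` Omega)) => //; exact: open_setX.
have dk := nbhs_singleton nk.
apply: ge0_approx => e e0.
(* The sum of the norms of the coefficients that multiply the five remainders [r1] to [r5]. *)
pose c := `|y| + `|y| + `|x| + `|x| + 1.
have c0 : 0 < c by rewrite ltr_wpDl// !addr_ge0.
have e10 : 0 < e / c by rewrite divr_gt0.
have H1 := line_remainder B (polar_near Oz Ow) e10.
have H2 := line_remainder A (polar_near Ow Oz) e10.
have H3 := line_remainder A dk e10.
have H4 := line_remainder B dk e10.
have H5 := second_difference A B nk e10.
have H6 : \forall t \near (0 : C), Omega (w + t *: conj_vec v).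
  by apply: near_line; apply: open_nbhs_nbhs.
have [t t0 [[[h1 h2] [h3 h4]] [h5 h6]]] := near0_gt0
  (near_and (near_and (near_and H1 H2) (near_and H3 H4)) (near_and H5 H6)).
have tr : t^* = t by apply/CrealP; exact: gtr0_real.
have tn : t != 0 by rewrite gt_eqF.
set wt := w + t *: conj_vec v in h6.
have cwt : conj_vec (conj_vec w + t *: v) = wt.
  by rewrite conj_vecD conj_vecK conj_vecZ tr.
have E1 : k ((z, conj_vec w) + t *: B) = K z wt.
  by rewrite /k /polar /= scaler0 addr0 cwt.
have E2 : k ((w, conj_vec z) + t *: A) = K wt z.
  by rewrite /k /polar /= scaler0 addr0 conj_vecK.
have E3 : k (p + t *: A) = K wt w by rewrite /k /polar /= scaler0 addr0 conj_vecK.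
have E4 : k (p + t *: B) = K w wt by rewrite /k /polar /= scaler0 addr0 cwt.
have E5 : k (p + t *: A + t *: B) = K wt wt.
  by rewrite /k /polar /= !scaler0 !addr0 cwt.
have F1 : k (z, conj_vec w) = K z w by rewrite /k /polar /= conj_vecK.
have F2 : k (w, conj_vec z) = K w z by rewrite /k /polar /= conj_vecK.
have F3 : k p = K w w by rewrite /k /polar /= conj_vecK.
move: h1 h2 h3 h4 h5; rewrite -/k E1 E2 E3 E4 E5 F1 F2 F3.
move: ('D_B k (z, conj_vec w)) ('D_A k (w, conj_vec z)) ('D_A k p) ('D_B k p)
  ('D_A ('D_B k) p) => b1 a1 a b g h1 h2 h3 h4 h5.
(* The kernel form at [z], [w], [wt] with weights [y], [x^* - t^-1], [t^-1]. The second variable is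
   conjugated, so moving [w] by [t *: conj_vec v] differentiates [polar K] along [(0, v)]. *)
exists (y * y^* * K z z + (x^* - t^-1) * y^* * K w z + t^-1 * y^* * K wt z
     + y * (x - t^-1) * K z w + (x^* - t^-1) * (x - t^-1) * K w w + t^-1 * (x - t^-1) * K wt w
     + y * t^-1 * K z wt + (x^* - t^-1) * t^-1 * K w wt + t^-1 * t^-1 * K wt wt).
  have ts : (t^-1)^* = t^-1 by rewrite fmorphV /= tr.
  have xs : (x^* - t^-1)^* = x - t^-1 by rewrite rmorphB /= conjCK ts.
  by have := kernel3_ge0 y (x^* - t^-1) t^-1 Oz Ow h6; rewrite ts xs.
set r1 := _ - t * b1 in h1; set r2 := _ - t * a1 in h2; set r3 := _ - t * a in h3.
set r4 := _ - t * b in h4; set r5 := _ - t ^+ 2 * g in h5.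
set L := (X in `|X|).
have -> : L = - (y * (r1 / t) + y^* * (r2 / t) + x * (r3 / t) + x^* * (r4 / t) + r5 / t ^+ 2).
  by rewrite /L /r1 /r2 /r3 /r4 /r5; field.
have tp : 0 < `|t| by rewrite normr_gt0.
have q r (u : C) : `|r| <= e / c * `|t| -> `|u * (r / t)| <= `|u| * (e / c).
  by move=> hr; rewrite normrM ler_wpM2l// normrM normfV ler_pdivrMr.
have q5 : `|r5 / t ^+ 2| <= e / c.
  by rewrite normrM normfV normrX ler_pdivrMr ?exprn_gt0.
rewrite normrN.
have -> : e = `|y| * (e / c) + `|y^*| * (e / c) + `|x| * (e / c) + `|x^*| * (e / c) + e / c.
  rewrite !norm_conjC -!mulrDl -[e / c in X in _ + X]mul1r -mulrDl -/c mulrC divfK//.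
  by rewrite gt_eqF.
apply: (le_trans (ler_normD _ _)); apply: lerD => //.
do 2 ![apply: (le_trans (ler_normD _ _)); apply: lerD; last by apply: q].
by apply: (le_trans (ler_normD _ _)); apply: lerD; apply: q.
Qed.

End Kernel.

(** * Strict positivity of the jets of a kernel and of its powers *)

Section Main.
Variables (R : realType) (m : nat).
Local Notation C := (CC R).
Local Notation V := 'rV[C]_m.
Variables (Omega : set V) (K : V -> V -> C).
Hypothesis Omega_open : open Omega.
Hypothesis K_pos : positive_definite_kernel Omega K.
Hypothesis K_hol : sesquiholomorphic (Omega `*` Omega) K.
Hypothesis K_ind : forall w, Omega w -> independent_at Omega K w.

Definition consv (x : C) (v : V) : 'rV[C]_m.+1 :=
  \row_i if unlift ord0 i is Some k then v 0 k else x.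

Lemma jet_form_gt0 (w : V) (x : C) (v : V) : Omega w -> (x != 0) || (v != 0) ->
  0 < jet_form K w x v.
Proof.
move=> Ow xv0.
have H z (y : C) := kernel_jet_ge0 Omega_open K_pos K_hol v x y (z := z) (w := w).
have Q0 : 0 <= jet_form K w x v.
  have e (D E G Q : C) : 0 * 0^* * D + 0 * E + 0^* * G + Q = Q.
    by rewrite rmorph0 !mul0r !add0r.
  by have := H w 0 Ow Ow; rewrite e.
rewrite lt_def Q0 andbT; apply: contraTneq xv0 => Q1.
have c0 : consv x v = 0.
  apply: (K_ind Ow) => z Oz.
  have Z : x * K z w + 'D_((0, v) : V * V) (polar K) (z, conj_vec w) = 0.
    apply: sesquilinear_zero => y; have Hy := H z y Oz Ow.
    by rewrite Q1 addr0 in Hy; exact: Hy.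
  have S : 'D_((0, v) : V * V) (polar K) (z, conj_vec w)
     = \sum_k v 0 k * partial_bar (lift ord0 k) K z w.
    apply: etrans (congr1 (fun u => 'D_u (polar K) (z, conj_vec w)) (pair_sum2 v)) _.
    apply: etrans (D_lincomb _ _ _ (polar_near K_hol Oz Ow)) _.
    by apply: eq_bigr => k _; rewrite partial_barS.
  rewrite big_ord_recl partial_bar0 mxE unlift_none -{2}Z S; congr (_ + _).
  by apply: eq_bigr => k _; rewrite mxE liftK.
have x0 : x = 0 by have /rowP/(_ ord0) := c0; rewrite !mxE unlift_none.
have v0 : v = 0.
  by apply/rowP => k; have /rowP/(_ (lift ord0 k)) := c0; rewrite !mxE liftK.
by rewrite x0 v0 !eqxx.
Qed.

Lemma jet_form0 (F : V -> V -> C) (w : V) (x : C) :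
  jet_form F w x 0 = x * x^* * F w w.
Proof.
rewrite /jet_form.
have -> : (conj_vec 0, 0) = 0 :> V * V.
  by apply: injective_projections => //=; apply/rowP => i; rewrite !mxE rmorph0.
have -> : (0, 0) = 0 :> V * V by [].
by rewrite !derive0 !mulr0 !addr0 /polar /= conj_vecK.
Qed.

Lemma kernel_gt0 (w : V) : Omega w -> 0 < K w w.
Proof.
move=> Ow; have := @jet_form_gt0 w 1 0 Ow; rewrite oner_eq0 => /(_ isT).
by rewrite jet_form0 rmorph1 !mul1r.
Qed.

Lemma Re_kernel_gt0 (w : V) : Omega w -> 0 < complex.Re (K w w).
Proof. by move=> /kernel_gt0; rewrite ltcE => /andP[]. Qed.

Definition positive_real_locus : set (V * V) :=
  [set p | [/\ Omega p.1, Omega p.2 & 0 < complex.Re (K p.1 p.2)]].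

Definition principal_power (lam : R) (z w : V) : C := cpow lam (K z w).

Lemma open_positive_real_locus : open positive_real_locus.
Proof.
rewrite openE => -[z w] [/= Oz Ow zw0].
have ck : {for (z, conj_vec w), continuous (polar K)}.
  exact: differentiable_continuous (polar_near K_hol Oz Ow).
have kzw : polar K (z, conj_vec w) = K z w by rewrite /polar /= conj_vecK.
have n1 : \forall q \near (z, conj_vec w), 0 < complex.Re (polar K q).
  by apply: (ck (fun t : C => 0 < complex.Re t)); apply: near_Re_gt0; rewrite kzw.
have n2 : \forall q \near (z, w), 0 < complex.Re (polar K (q.1, conj_vec q.2)).
  exact: (@continuous_swap_conj R m (z, w) _ n1).
have n3 : \forall q \near (z, w), (Omega `*` Omega) q.
  by apply: open_nbhs_nbhs; split=> //; exact: open_setX.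
apply: filterS2 n2 n3 => -[a b] /= ab0 [Oa Ob]; split=> //.
by move: ab0; rewrite /polar /= conj_vecK.
Qed.

Lemma principal_power_polarizes (lam : R) :
  is_kernel_power Omega K lam (principal_power lam).
Proof.
exists positive_real_locus; split.
- exact: open_positive_real_locus.
- by move=> p [].
- by move=> w Ow; split=> //; exact: Re_kernel_gt0.
- move=> [z w] [/= Oz Ow zw0].
  apply: (@cpow_comp_differentiable _ _ lam (polar K)).
    exact: (polar_near K_hol).
  by rewrite /polar /= conj_vecK.
- move=> w Ow; rewrite /principal_power.
  have k0 := Re_kernel_gt0 Ow.
  have -> : K w w = toC R (complex.Re (K w w)).
    by have := kernel_gt0 Ow; rewrite ltcE; case: (K w w) => a b /= /andP[/eqP -> _].
  by rewrite cpow_real.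
Qed.

(** This transfers the computation for [principal_power] to [kernel_power], of which nothing is
    known except that it is a polarization. *)
Lemma jet_form_power_unique (lam : R) (F G : V -> V -> C) (w : V) (x : C) (v : V) :
    is_kernel_power Omega K lam F -> is_kernel_power Omega K lam G -> Omega w ->
  jet_form F w x v = jet_form G w x v.
Proof.
move=> [W1 [oW1 _ dW1 hF FK]] [W2 [oW2 _ dW2 hG GK]] Ow.
have nF := sesqui_near oW1 (dW1 _ Ow) hF.
have nG := sesqui_near oW2 (dW2 _ Ow) hG.
have FG : \forall z \near w, polar F (z, conj_vec z) = polar G (z, conj_vec z).
  have nO : \forall z \near w, Omega z by apply: open_nbhs_nbhs.
  by apply: filterS nO => z Oz; rewrite /polar /= conj_vecK FK// GK.
have D1 u := diff_diag_eq (nbhs_singleton nF) (nbhs_singleton nG) FG u.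
have D2 := diff2_diag_eq nF nG FG.
exact: (f_equal2 +%R (f_equal2 +%R (f_equal2 +%R
  (congr1 ( *%R (x * x^* )) (nbhs_singleton FG)) (congr1 ( *%R x) (D1 _)))
  (congr1 ( *%R x^* ) (D1 _))) (D2 _ _)).
Qed.

Lemma jet_form_principal_power_gt0 (lam : R) (w : V) (x : C) (v : V) :
    0 < lam -> Omega w -> (x != 0) || (v != 0) ->
  0 < jet_form (principal_power lam) w x v.
Proof.
move=> l0 Ow; have k0 := Re_kernel_gt0 Ow; have kp := kernel_gt0 Ow.
have pos (l : R) : 0 < cpow l (K w w).
  have -> : K w w = toC R (complex.Re (K w w)).
    by have := kp; rewrite ltcE; case: (K w w) => a b /= /andP[/eqP -> _].
  by rewrite cpow_real// -(rmorph0 (toC R)) toC_lt powR_gt0.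
(* For [v = 0] the Schur complement vanishes, and positivity comes from [x] alone. *)
have [->|v0 _] := eqVneq v 0.
  rewrite orbF => x0; rewrite jet_form0 pmulr_rgt0 ?pos//.
  by rewrite lt_def mul_conjC_ge0 andbT mul_conjC_eq0.
have nK := sesqui_near (open_setX Omega_open Omega_open) (conj Ow Ow : (Omega `*` Omega) (w, w)) K_hol.
have dK := nbhs_singleton nK.
have kE : polar K (w, conj_vec w) = K w w by rewrite /polar /= conj_vecK.
have kre : 0 < complex.Re (polar K (w, conj_vec w)) by rewrite kE.
have kr : (K w w)^* = K w w by apply/CrealP; exact: gtr0_real.
have J y : 0 < jet_form K w y v by apply: jet_form_gt0 => //; rewrite v0 orbT.
pose k := polar K; pose p := (w, conj_vec w).
pose A : V * V := (conj_vec v, 0); pose B : V * V := (0, v).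
have E : jet_form (principal_power lam) w x v = x * x^* * cpow lam (k p)
    + x * (toC R lam * (cpow (lam - 1) (k p) * 'D_A k p))
    + x^* * (toC R lam * (cpow (lam - 1) (k p) * 'D_B k p))
    + toC R lam * (cpow (lam - 1) (k p) * 'D_A ('D_B k) p
        + 'D_B k p * (toC R (lam - 1) * (cpow (lam - 1 - 1) (k p) * 'D_A k p))).
  exact: (f_equal2 +%R (f_equal2 +%R (f_equal2 +%R
    (erefl (x * x^* * cpow lam (k p))) (congr1 ( *%R x) (cpow_comp_D lam A dK kre)))
    (congr1 ( *%R x^* ) (cpow_comp_D lam B dK kre))) (cpow_comp_D2 lam A B nK kre)).
have {}J y : 0 < y * y^* * k p + y * 'D_A k p + y^* * 'D_B k p + 'D_A ('D_B k) p by exact: J.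
rewrite {}E; move: J.
move: ('D_A k p) ('D_B k p) ('D_A ('D_B k) p) => a b g.
have -> : k p = K w w by exact: kE.
move=> J.
rewrite (cpow_pred lam k0) (cpow_pred (lam - 1) k0) [toC R (lam - 1)]rmorphB rmorph1.
have ab : b^* = a by apply: (hermitian_of_ge0 kr) => y; exact: ltW (J y).
(* The two uses of [cpow_pred] have expressed all powers through
   [Q = cpow (lam - 1 - 1) (K w w)]. *)
apply: power_form_gt0; [exact: kp| | |by rewrite ab|].
- by rewrite -(rmorph0 (toC R)) toC_lt.
- exact: pos.
(* This point minimizes the form with exponent one in its scalar variable; the value there is the
   Schur complement. *)
- have := J (- b / K w w); congr (0 < _).
  rewrite rmorphM rmorphN fmorphV /= kr ab; field.
  by rewrite gt_eqF.
Qed.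

End Main.
Unset Implicit Arguments.
Set Strict Implicit.

Theorem theorem2p2 (R : realType) (m : nat) (Omega : set 'rV[CC R]_m)
    (K : 'rV[CC R]_m -> 'rV[CC R]_m -> CC R) :
  bounded_domain Omega ->
  positive_definite_kernel Omega K ->
  sesquiholomorphic (Omega `*` Omega) K ->
  (forall w, Omega w -> independent_at Omega K w) ->
  forall (w : 'rV[CC R]_m) (lambda : R), Omega w -> 0 < lambda ->
    pos_definite (\matrix_(i < m.+1, j < m.+1)
      partial j (partial_bar i (kernel_power Omega K lambda)) w w).
Proof.
move=> [oO _ _ _] Kp Kh Ki w lam Ow l0 v v0.
have Pp := principal_power_polarizes oO Kp Kh Ki lam.
(* A polarization exists, so [xget] does not return its default value zero. *)
have Pk : is_kernel_power Omega K lam (kernel_power Omega K lam).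
  by apply: (@xgetPex _ (fun _ _ => 0) [set F | is_kernel_power Omega K lam F]);
    exists (principal_power K lam).
have [W [oW _ dW hF _]] := Pk.
apply: (@eq_ind_r _ _ (fun t => 0 < t) _ _ (form_expand v (sesqui_near oW (dW _ Ow) hF))).
rewrite (jet_form_power_unique oO _ _ Pk Pp Ow).
apply: (jet_form_principal_power_gt0 oO Kp Kh Ki) => //.
rewrite -negb_and; apply: contra v0 => /andP[/eqP x0 /eqP t0].
apply/eqP/rowP => i; rewrite mxE; case: (unliftP ord0 i) => [k ->|->] //.
by have /rowP/(_ k) := t0; rewrite !mxE.
Qed.
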